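(* Let $d_i,d_u>1$ and $c_i,c_u>0$, and let $G=(V,\mathcal{E})$ be an infinite connected locally finite graph satisfying the local isoperimetric inequality $\mathcal{L}(d_i,c_i)$ and the volume upper bound $\mathcal{V}_u(d_u,c_u)$. If $G$ has bounded degree, then each of the Ising model, the Widom–Rowlinson model and the beach model undergoes a non-trivial phase transition on $G$. For the Ising model the conclusion holds also without the assumption of bounded degree.
   Context: $d(\cdot,\cdot)$ is the graph distance, and $B(x,r)=\{y\in V: d(x,y)\le r\}$. For $A\subseteq B\subseteq V$, $\partial_B A=\{\{x,y\}\in\mathcal{E}: x\in A,\ y\in B\setminus A\}$. $\mathcal{L}(d_i,c_i)$: for every $x\in V$, $r\ge 1$ and every $A\subseteq B:=B(x,r)$ with $|A|\le |B(x,r)|/2$, one has $|\partial_B A|\ge c_i|A|^{(d_i-1)/d_i}$. $\mathcal{V}_u(d_u,c_u)$: $|B(x,r)|\le c_u r^{d_u}$ for all $x\in V$, $r\ge1$. A model undergoes a non-trivial phase transition on $G$ if for some value of its parameter there is more than one Gibbs measure. A Gibbs measure is a probability measure $\mu$ on $S^V$ ($S$ the finite spin set) such that for every finite $\Lambda\subset V$ and $\mu$-a.e. $\eta$, the conditional law under $\mu$ of the spins in $\Lambda$ given that the configuration equals $\eta$ off $\Lambda$ gives to each $\xi\in S^\Lambda$ a probability proportional to the weight of the configuration equal to $\xi$ on $\Lambda$ and $\eta$ off $\Lambda$. The weights are as follows, where only vertices in $\Lambda$ and edges with at least one endpoint in $\Lambda$ are taken into account. - Ising model (parameter: inverse temperature/coupling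 $J\ge0$, zero external field): $S=\{-1,1\}$, weight $\exp\big(J\sum_{\{x,y\}}\xi(x)\xi(y)\big)$, the sum being over edges. - Widom–Rowlinson model (parameter: activity $\lambda>0$): $S=\{-1,0,1\}$, weight $\lambda^{\#\{x:\xi(x)\neq0\}}$ if no edge has one endpoint with spin $-1$ and the other with spin $+1$, and weight $0$ otherwise. - Beach model (parameter $M>1$): $S=\{-2,-1,1,2\}$, weight $(M-1)^{\#\{x:|\xi(x)|=2\}}$ if $\xi(x)\xi(y)\ge-1$ for every edge $\{x,y\}$ (i.e. spins of opposite sign may be adjacent only if both have absolute value $1$), and weight $0$ otherwise. *)

(* Defs.v *)
From HB Require Import structures.
From mathcomp Require Import all_boot all_order all_algebra.
From mathcomp Require Import finmap.
From mathcomp Require Import all_classical all_reals all_analysis.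

Set Implicit Arguments.
Unset Strict Implicit.
Unset Printing Implicit Defensive.

Import Order.TTheory GRing.Theory Num.Theory.

Local Open Scope classical_set_scope.
Local Open Scope ring_scope.

(* Only meaningful on finite sets: an infinite set gets the value 0. *)
Definition setcard (T : choiceType) (A : set T) : nat := #|` fset_set A|%fset.

(* A simple graph on V is a symmetric irreflexive adjacency relation e; an edge
   is the unordered pair of its two endpoints. *)
Section Graphs.
Variables (V : choiceType) (e : rel V).

Definition has_walk (x y : V) (n : nat) : bool :=
  `[< exists p : seq V, [/\ path e x p, last x p = y & size p = n] >].

Definition connected_graph : Prop := forall x y, exists n, has_walk x y n.

Definition locally_finite : Prop := forall x, finite_set [set y | e x y].

Definition bounded_degree : Prop :=
  exists D : nat, forall x, (setcard [set y | e x y] <= D)%N.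

(* The default 0 is used only when x and y lie in different components. *)
Definition gdist (x y : V) : nat :=
  if pselect (exists n, has_walk x y n) is left h then ex_minn h else 0%N.

Definition gball (R : realType) (x : V) (r : R) : set V :=
  [set y | (gdist x y)%:R <= r].

Definition edge_boundary (B A : set V) : set {fset V} :=
  [set b | exists x y, [/\ e x y, A x, (B `\` A) y & b = [fset x; y]%fset]].

Definition edges_meeting (L : {fset V}) : set {fset V} :=
  [set b | exists x y, [/\ e x y, x \in L & b = [fset x; y]%fset]].

Definition local_isoperimetric (R : realType) (d c : R) : Prop :=
  forall (x : V) (r : R), 1 <= r -> forall A : set V,
    A `<=` gball x r ->
    (setcard A)%:R <= (setcard (gball x r))%:R / 2 :> R ->
    c * (setcard A)%:R `^ ((d - 1) / d)
      <= (setcard (edge_boundary (gball x r) A))%:R.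

Definition volume_upper_bound (R : realType) (d c : R) : Prop :=
  forall (x : V) (r : R), 1 <= r -> (setcard (gball x r))%:R <= c * r `^ d.

End Graphs.

(* The base point plays no role; it is there because measurable types are
   required to be pointed. *)
#[short(type="finPointedType")]
HB.structure Definition FinPointed := {T of Finite T & Pointed T}.

Section Gibbs.
Variables (R : realType) (V : choiceType) (S : finPointedType).

Definition cylinders (D : set V) : set (set (V -> S)) :=
  [set [set s : V -> S | s x = a] | x in D & a in [set: S]].

(* S^V with the product sigma-algebra *)
Definition config := g_sigma_algebraType (cylinders [set: V]).

(* the same set with the sigma-algebra generated by the spins off L *)
Definition config_off (L : {fset V}) :=
  g_sigma_algebraType (cylinders (~` [set` L])).

Definition splice (L : {fset V}) (xi : {ffun L -> S}) (eta : V -> S) : V -> S :=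
  fun x => if insub x is Some u then xi u else eta x.

(* p is a version of the conditional law under mu of the spins in L given the
   configuration off L. *)
Definition is_cond_law (mu : probability config R) (L : {fset V})
    (p : (V -> S) -> {ffun L -> S} -> R) : Prop :=
  [/\ forall eta xi, 0 <= p eta xi,
      forall eta, \sum_xi p eta xi = 1,
      forall xi, measurable_fun [set: config_off L]
                   ((fun eta => p eta xi) : config_off L -> R)
    & forall (xi : {ffun L -> S}) (B : set (config_off L)), measurable B ->
        mu (B `&` [set s : V -> S | forall u : L, s (val u) = xi u])
        = (\int[mu]_(eta in B) (p eta xi)%:E)%E].

(* w L s is the weight of s, counting only the vertices in L and the edges with
   an endpoint in L. *)
Definition is_gibbs (w : {fset V} -> (V -> S) -> R)
    (mu : probability config R) : Prop :=
  forall L : {fset V}, exists2 p : (V -> S) -> {ffun L -> S} -> R,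
    is_cond_law mu p &
    {ae mu, forall eta, exists c : R, forall xi, p eta xi = c * w L (splice xi eta)}.

(* Measures are compared on measurable sets only, since a measure may take
   arbitrary values on the other sets. *)
Definition multiple_gibbs (w : {fset V} -> (V -> S) -> R) : Prop :=
  exists mu nu : probability config R,
    [/\ is_gibbs w mu, is_gibbs w nu &
        exists2 A : set config, measurable A & mu A <> nu A].

End Gibbs.

Definition ising_spin := seq_sub [:: -1; 1 : int].
HB.instance Definition _ := Finite.on ising_spin.
HB.instance Definition _ :=
  isPointed.Build ising_spin (@SeqSub int [:: -1; 1] 1 isT).

Definition wr_spin := seq_sub [:: -1; 0; 1 : int].
HB.instance Definition _ := Finite.on wr_spin.
HB.instance Definition _ :=
  isPointed.Build wr_spin (@SeqSub int [:: -1; 0; 1] 0 isT).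

Definition beach_spin := seq_sub [:: -2; -1; 1; 2 : int].
HB.instance Definition _ := Finite.on beach_spin.
HB.instance Definition _ :=
  isPointed.Build beach_spin (@SeqSub int [:: -2; -1; 1; 2] 1 isT).

Section Models.
Variables (R : realType) (V : choiceType) (e : rel V).

(* For b = {x, y} the inner product is s(x) s(y). *)
Definition ising_weight (J : R) (L : {fset V}) (s : V -> ising_spin) : R :=
  expR (J * \sum_(b \in edges_meeting e L)
              (\prod_(x <- enum_fset b) (ssval (s x))%:~R : R)).

Definition wr_weight (lambda : R) (L : {fset V}) (s : V -> wr_spin) : R :=
  if `[< forall x y, e x y -> x \in L \/ y \in L ->
           ~ (ssval (s x) = -1 /\ ssval (s y) = 1) >]
  then lambda ^+ #|` [fset x in L | ssval (s x) != 0%R]%fset|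
  else 0.

Definition beach_weight (M : R) (L : {fset V}) (s : V -> beach_spin) : R :=
  if `[< forall x y, e x y -> x \in L \/ y \in L ->
           -1 <= ssval (s x) * ssval (s y) >]
  then (M - 1) ^+ #|` [fset x in L | `|ssval (s x)| == 2%R]%fset|
  else 0.

Definition ising_phase_transition : Prop :=
  exists2 J : R, 0 <= J & multiple_gibbs (ising_weight J).

Definition wr_phase_transition : Prop :=
  exists2 lambda : R, 0 < lambda & multiple_gibbs (wr_weight lambda).

Definition beach_phase_transition : Prop :=
  exists2 M : R, 1 < M & multiple_gibbs (beach_weight M).

End Models.

(* Main.v *)
Require Import Defs.
From HB Require Import structures.
From mathcomp Require Import all_boot all_order all_algebra.
From mathcomp Require Import finmap zify ring lra.
From mathcomp Require Import all_classical all_reals all_analysis.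
From mathcomp Require Import measurable_realfun.
Import Order.TTheory GRing.Theory Num.Theory.
Import numFieldNormedType.Exports.
Local Open Scope classical_set_scope.
Local Open Scope ring_scope.
Set Implicit Arguments.
Unset Strict Implicit.
Unset Printing Implicit Defensive.

(** Each model has two extremal constant boundary conditions, exchanged by a
    flip of signs. If the spin at a fixed vertex o follows the boundary with
    probability at least 5/8, uniformly in the volume, then the infinite-volume
    limits for the two boundary conditions are distinct Gibbs measures
    ([two_phases], [gibbs_limit]).

    Peierls' argument. To each configuration is attached a random set of closed
    vertices: the ends of disagreement edges (Ising), the empty sites
    (Widom-Rowlinson), the sites of absolute value 1 (beach). When the spin at o
    is opposite to the boundary, the component of o in that sign is finite, and
    every edge leaving it has a closed end: it is sealed. It therefore suffices
    that (a) a given set Z is closed with probability at most eps ^ |Z|, with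
    eps small at a suitable parameter ([frustrated_bound], [weak_bound]), and
    that (b) there are few ways of sealing o off ([peierls_families]).

    For (a), degrees are bounded, by the volume bound at radius 1. In the two
    site models, making a site strong and giving the boundary sign to the
    clusters around it multiplies the weight by a large factor and is boundedly
    many to one. In the Ising model, a disagreement is paid for by a lower
    coupling, and Griffiths' inequality shows that lower couplings do not
    increase the partition function.

    For (b), cutsets are not enumerated. Instead, a ball of scale n is bad when
    closed vertices separate two large connected sets in it. The local
    isoperimetric inequality shows that a bad ball of scale n ^ g contains m
    disjoint bad balls of scale n, where m is fixed in advance and n is large
    ([cascade]): otherwise the few bad balls would be a bottleneck between two
    large sets. By induction, a bad
    ball of scale k contains one of at most M ^ (m ^ k) prescribed sets of
    m ^ k closed vertices; with m > g the entropy of the positions of the balls,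
    controlled by the volume bound, does not spoil this ([bad_family]). Finally,
    a finite sealed set around o produces a bad ball at some scale, not too far
    from o for that scale ([sealed_bad]).

    A Gibbs measure is obtained from the finite-volume ones by taking limits of
    the probabilities of all events along an ultrafilter; the resulting finitely
    additive probability agrees on local events with the law of a configuration
    sampled from a uniform variable ([extension]), and the finite-volume
    conditional laws pass to the limit. *)

(** * Cardinality, distance and connected sets *)

Section FinCard.
Variable T : choiceType.
Implicit Types A B : set T.

Lemma setcard_le A B : finite_set B -> A `<=` B -> (setcard A <= setcard B)%N.
Proof.
move=> fB AB; apply/fsubset_leq_card; rewrite -fset_set_sub //.
exact: sub_finite_set fB.
Qed.

Lemma setcardU_le A B : finite_set A -> finite_set B ->
  (setcard (A `|` B) <= setcard A + setcard B)%N.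
Proof. by move=> fA fB; rewrite /setcard fset_setU// cardfsU leq_subr. Qed.

Lemma setcard_le_seq A (s : seq T) :
  (forall x, A x -> x \in s) -> (setcard A <= size s)%N.
Proof.
move=> As; have fA : finite_set A.
  by apply: (@sub_finite_set _ _ [set` s]) => //; exact: finite_seq.
apply: uniq_leq_size; first exact: fset_uniq.
by move=> x; rewrite in_fset_set// inE => /As.
Qed.

End FinCard.

Class infinite_graph (V : choiceType) (e : rel V) : Prop := InfiniteGraph {
  graph_sym : symmetric e;
  graph_connected : connected_graph e;
  graph_locally_finite : locally_finite e;
  graph_infinite : infinite_set [set: V] }.

Section GraphDist.
Context {V : choiceType} {e : rel V} {G : infinite_graph e}.

Local Notation d := (gdist e).

Lemma edge_sym x y : e x y -> e y x.
Proof. by rewrite (graph_sym (e := e)). Qed.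

Lemma gdistP x y : has_walk e x y (d x y).
Proof.
by rewrite /gdist; case: pselect => [h|[]]; [case: ex_minnP | exact: graph_connected].
Qed.

Lemma gdist_min x y n : has_walk e x y n -> (d x y <= n)%N.
Proof.
move=> w; rewrite /gdist; case: pselect => [h|//].
by case: ex_minnP => k _; apply.
Qed.

Lemma gdistxx x : d x x = 0%N.
Proof. by apply/eqP; rewrite -leqn0; apply: gdist_min; apply/asboolP; exists [::]. Qed.

Lemma gdist_triangle x y z : (d x z <= d x y + d y z)%N.
Proof.
have /asboolP[p [pp <- <-]] := gdistP x y.
have /asboolP[q [qp <- <-]] := gdistP (last x p) z.
apply: gdist_min; apply/asboolP; exists (p ++ q).
by rewrite cat_path last_cat size_cat pp.
Qed.

Lemma gdist_sym x y : d x y = d y x.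
Proof.
suff H u v : (d u v <= d v u)%N by apply/eqP; rewrite eqn_leq !H.
have /asboolP[p [pp lp sp]] := gdistP v u.
rewrite -sp; apply: gdist_min; apply/asboolP.
exists (rev (belast v p)); split; last by rewrite size_rev size_belast.
- rewrite -lp -rev_path in pp *.
  by rewrite (eq_path (e' := fun z => e^~ z)) // => a b; rewrite graph_sym.
- by case: p {pp sp} lp => //= a p _; rewrite rev_cons last_rcons.
Qed.

Lemma gdist_edge x y : e x y -> (d x y <= 1)%N.
Proof.
by move=> xy; apply: gdist_min; apply/asboolP; exists [:: y]; rewrite /= xy.
Qed.

Lemma gdist_step x y z : e y z -> (d x z <= (d x y).+1)%N.
Proof.
by move=> yz; have := gdist_triangle x y z; have := gdist_edge yz; lia.
Qed.

Lemma gdist_pred x y n : (d x y <= n.+1)%N ->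
  (d x y <= n)%N \/ exists2 z, (d x z <= n)%N & e z y.
Proof.
have /asboolP[p [pp lp sp]] := gdistP x y.
case: (leqP (d x y) n) => [|nd dn]; first by left.
right; case/lastP: p pp lp sp => [|p z]; first by move=> _ _ /= sp; move: nd; rewrite -sp.
rewrite rcons_path last_rcons size_rcons => /andP[pp zy] yz sp; subst z.
exists (last x p) => //; apply: (@leq_trans (size p)); last by lia.
by apply: gdist_min; apply/asboolP; exists p.
Qed.

Definition nball (x : V) (r : nat) : set V := [set y | (d x y <= r)%N].

Lemma nball_finite x r : finite_set (nball x r).
Proof.
elim: r => [|r IH].
- apply: (@sub_finite_set _ _ [set x]) => // y; rewrite /nball/= leqn0 => /eqP d0.
  have := gdistP x y; rewrite d0 => /asboolP[p [_ <- /size0nil ->]] //.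
- apply: (@sub_finite_set _ _ (nball x r `|` \bigcup_(z in nball x r) [set y | e z y])).
    by move=> y /= /gdist_pred[|[z zr zy]]; [left | right; exists z].
  by rewrite finite_setU; split => //; apply: bigcup_finite => // *; exact: graph_locally_finite.
Qed.

Lemma nball_mono x r s : (r <= s)%N -> nball x r `<=` nball x s.
Proof. by move=> rs y /= /leq_trans; apply. Qed.

(** [reach A a] is the connected component of a in A, as a set. *)
Inductive reach (A : set V) (a : V) : V -> Prop :=
| reach0 : A a -> reach A a a
| reachS u v : reach A a u -> e u v -> A v -> reach A a v.

Definition connected_in (A : set V) := forall a b, A a -> A b -> reach A a b.

Lemma reach_in A a u : reach A a u -> A u.
Proof. by case. Qed.

Lemma reach_trans A a b c : reach A a b -> reach A b c -> reach A a c.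
Proof. by move=> ab; elim=> // u v _ au uv Av; apply: reachS uv Av. Qed.

Lemma reach_sym A a b : reach A a b -> reach A b a.
Proof.
elim=> [Aa|u v au ua uv Av]; first exact: reach0.
apply: reach_trans ua; apply: reachS (reach0 Av) _ (reach_in au).
by rewrite graph_sym.
Qed.

Lemma reach_mono A B a b : A `<=` B -> reach A a b -> reach B a b.
Proof.
move=> AB; elim=> [/AB Ba|u v _ au uv /AB Bv]; first exact: reach0.
exact: reachS uv Bv.
Qed.

Lemma reach_comp A a b : reach A a b -> reach (reach A a) a b.
Proof.
elim=> [Aa|u v au IH uv Av]; first by apply: reach0; exact: reach0.
by apply: (reachS IH uv); apply: (reachS au uv Av).
Qed.

Lemma comp_connected A a : connected_in (reach A a).
Proof.
move=> u v /reach_comp au /reach_comp av.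
exact: reach_trans (reach_sym au) av.
Qed.

Lemma connected_setT : connected_in [set: V].
Proof.
move=> a b _ _; have /asboolP[p [pp <- _]] := gdistP a b.
elim/last_ind: p pp => [_|p z IH]; first exact: reach0.
by rewrite rcons_path last_rcons => /andP[/IH pz lz]; apply: reachS pz lz _.
Qed.

Lemma ball_connected x r y : nball x r y -> reach (nball x r) x y.
Proof.
elim: r y => [|r IH] y; rewrite /nball/=.
  rewrite leqn0 => /eqP d0.
  have := gdistP x y; rewrite d0 => /asboolP[p [_ <- /size0nil ->]] /=.
  by apply: reach0; rewrite /nball/= gdistxx.
move=> dy; have sub : nball x r `<=` nball x r.+1 by apply: nball_mono.
case: (gdist_pred dy) => [|[z zr zy]]; first by move/IH; exact: reach_mono.
by apply: (reachS _ zy) => //; apply: (reach_mono sub); exact: IH.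
Qed.

Lemma nball_connected_in x r : connected_in (nball x r).
Proof.
move=> a b /ball_connected xa /ball_connected xb.
exact: reach_trans (reach_sym xa) xb.
Qed.

(** Discrete intermediate values: the distance to y changes by at most one at
    each step of a walk, so that either the walk stays in the ball, or the part
    of it before its first exit meets every sphere. *)
Lemma reach_levels A a u y r : reach A a u -> (d y a <= r)%N ->
  (reach (A `&` nball y r) a u /\ forall j, (d y a <= j <= d y u)%N ->
     exists2 v, reach (A `&` nball y r) a v & d y v = j)
  \/ forall j, (d y a <= j <= r)%N ->
     exists2 v, reach (A `&` nball y r) a v & d y v = j.
Proof.
move=> au yar; elim: au => [Aa|s v as_ [[IH1 IH2]|IH] sv Av]; last by right.
  left; have ra : reach (A `&` nball y r) a a by apply: reach0.
  by split=> // j jj; exists a => //; lia.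
have dv := gdist_step y sv.
have ds : (d y s <= r)%N by have [] := reach_in IH1.
case: (leqP (d y v) r) => [vr|rv].
  have rv : reach (A `&` nball y r) a v by apply: (reachS IH1 sv).
  left; split=> // j jj; case: (leqP j (d y s)) => js; first by apply: IH2; lia.
  by exists v => //; lia.
by right=> j jj; apply: IH2; lia.
Qed.

Lemma levels_card C y i n : finite_set C ->
  (forall j, (i <= j < i + n)%N -> exists2 v, C v & d y v = j) ->
  (n <= setcard C)%N.
Proof.
move=> fC H; rewrite -(size_iota i n) /setcard -(size_map (d y)).
apply: uniq_leq_size; first exact: iota_uniq.
move=> j; rewrite mem_iota => /H[v Cv <-].
by apply: map_f; rewrite in_fset_set// inE.
Qed.

(** A large connected set either lies in the ball, or crosses all the spheres
    between a and the boundary of the ball. *)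
Lemma comp_large A a y n r : connected_in A -> finite_set A -> A a ->
  (n <= setcard A)%N -> (d y a + n <= r)%N ->
  (n <= setcard (reach (A `&` nball y r) a))%N.
Proof.
move=> cA fA Aa nA dr; have yar : (d y a <= r)%N by lia.
have fC : finite_set (reach (A `&` nball y r) a).
  by apply: sub_finite_set fA => u /reach_in[].
case: (pselect (forall j, (d y a <= j <= r)%N ->
     exists2 v, reach (A `&` nball y r) a v & d y v = j)) => [H|H].
  apply: (levels_card (y := y) (i := d y a)) => // j jj; apply: H; lia.
apply: leq_trans nA _; apply: setcard_le => // u Au.
by have [[]|] := reach_levels (cA _ _ Aa Au) yar.
Qed.

(** Balls are finite and the graph is infinite, so that some vertex lies beyond
    the sphere; a walk to it crosses the sphere. *)
Lemma exists_level y r : exists u, d y u = r.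
Proof.
have [u ur] : exists u, (r < d y u)%N.
  apply: contrapT => H; apply: graph_infinite.
  apply: sub_finite_set (nball_finite y r) => u _; rewrite /nball/=.
  by rewrite leqNgt; apply/negP => ?; apply: H; exists u.
have yyr : (d y y <= r)%N by rewrite gdistxx.
have [[/reach_in[_ yur] _]|] := reach_levels (connected_setT I I : reach setT y u) yyr.
  by move: ur yur; rewrite /nball/=; lia.
by move=> /(_ r)[|v _ <-]; [rewrite gdistxx; lia | exists v].
Qed.

Lemma nball_large y r : (r.+1 <= setcard (nball y r))%N.
Proof.
apply: (levels_card (y := y) (i := 0)); first exact: nball_finite.
by move=> j jr; have [v dv] := exists_level y j; exists v => //; rewrite /nball/= dv; lia.
Qed.

End GraphDist.
Arguments reach {V} e A a _.
Arguments connected_in {V} e A.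
Arguments nball {V} e x r _.
Arguments gdist_triangle {V e} G x y z.
Arguments gdist_step {V e} G x {y z}.

(** * Separation events and their cascade over scales *)

Section Separation.
Context {V : choiceType} {e : rel V} {G : infinite_graph e}.
Implicit Types (Cl : pred V) (A X : set V) (n : nat).

Local Notation d := (gdist e).

(** Edges that leave X are disregarded, which makes being sealed in a ball an
    event of that ball. *)
Definition sealed Cl X A := forall a b, e a b -> A a -> X b -> ~ A b ->
  Cl a \/ Cl b.

(** One side of a separation at scale n around x. The radius 4 n leaves room for
    a connected set that starts near x to collect n points in the ball. *)
Record region Cl n x A : Prop := Region {
  region_sub : A `<=` nball e x (4 * n);
  region_conn : connected_in e A;
  region_sealed : sealed Cl (nball e x (4 * n)) A;
  region_card : (n <= setcard A)%N;
  region_near : exists2 a, A a & (d x a <= n.+1)%N }.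

Definition bad Cl n x := exists A A', [/\ region Cl n x A, region Cl n x A' &
  forall u, A u -> ~ A' u].

Lemma region_finite Cl n x A : region Cl n x A -> finite_set A.
Proof. by move=> /region_sub sub; apply: (sub_finite_set sub); exact: nball_finite. Qed.

(** Being sealed is inherited by the trace on a smaller ball: a large region
    gives regions of a smaller scale all along it. *)
Lemma region_piece Cl n X A y a : (0 < n)%N -> nball e y (4 * n) `<=` X ->
  connected_in e A -> finite_set A -> sealed Cl X A -> (n <= setcard A)%N ->
  A a -> (d y a <= n.+1)%N ->
  region Cl n y (reach e (A `&` nball e y (4 * n)) a).
Proof.
move=> n0 BX cA fA sA nA Aa ya; split.
- by move=> u /reach_in[].
- exact: comp_connected.
- move=> u v uv ru Bv nrv; have [Au _] := reach_in ru.
  apply: (sA _ _ uv Au (BX _ Bv)) => Av; apply: nrv; exact: (reachS ru uv).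
- by apply: comp_large => //; lia.
- exists a => //; apply: reach0; split => //; rewrite /nball/=; lia.
Qed.

(** If the ball of radius n around y' missed A, its component off the trace of A
    would be a second region at y. Hence being close to A propagates from a good
    point to all its neighbours. *)
Lemma spread Cl n X A y a y' : (0 < n)%N -> nball e y (4 * n) `<=` X ->
  connected_in e A -> finite_set A -> sealed Cl X A -> (n <= setcard A)%N ->
  ~ bad Cl n y -> A a -> (d y a <= n)%N -> e y y' ->
  exists2 a', A a' & (d y' a' <= n)%N.
Proof.
move=> n0 BX cA fA sA nA ngood Aa ya yy'; apply: contrapT => H.
have far u : A u -> (n < d y' u)%N.
  by move=> Au; rewrite ltnNge; apply/negP => ?; apply: H; exists u.
have pP := region_piece n0 BX cA fA sA nA Aa (leqW ya).
set P := reach _ _ _ in pP.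
have PA u : P u -> A u by move=> /reach_in[].
have yy'1 := gdist_edge yy'.
have y'B : (nball e y (4 * n) `\` P) y'.
  split; first by rewrite /nball/=; lia.
  by move=> /PA/far; rewrite gdistxx.
apply: ngood; exists P, (reach e (nball e y (4 * n) `\` P) y'); split => //.
- split.
  + by move=> u /reach_in[].
  + exact: comp_connected.
  + move=> u v uv ru Bv nrv; have [Bu Pu] := reach_in ru.
    have Pv : P v by apply: contrapT => ?; apply: nrv; exact: (reachS ru uv).
    by have [] := region_sealed pP (edge_sym uv) Pv Bu Pu; [right|left].
  + apply: (@leq_trans (setcard (nball e y' n))).
      by apply: ltnW; exact: nball_large.
    apply: setcard_le.
      apply: (@sub_finite_set _ _ (nball e y (4 * n))); last exact: nball_finite.
      by move=> u /reach_in[].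
    move=> u /ball_connected; apply: reach_mono => v y'v; split.
      by have := gdist_triangle G y y' v; move: y'v; rewrite /nball/=; lia.
    by move=> /PA/far; move: y'v; rewrite /nball/=; lia.
  + by exists y'; [exact: reach0 | lia].
- by move=> u Pu /reach_in[].
Qed.

(** A greedy choice of points at mutual distance more than r. *)
Lemma far_or_covered (P : set V) r m :
  (exists ys : seq V, [/\ size ys = m, forall y, y \in ys -> P y &
     pairwise (fun u v => r < d u v)%N ys]) \/
  (exists2 ys : seq V, (size ys < m)%N &
     forall y, P y -> exists2 z, z \in ys & (d z y <= r)%N).
Proof.
elim: m => [|m [[ys [sy Py fy]]|[ys sy cy]]]; first by left; exists [::].
- case: (pselect (exists2 y, P y & all (fun v => r < d y v)%N ys)) => [[y Py' fy']|H].
    left; exists (y :: ys); split; rewrite /= ?sy ?fy' //.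
    by move=> z; rewrite inE => /predU1P[->|/Py].
  right; exists ys => [|y Py']; first by rewrite sy.
  apply: contrapT => H'; apply: H; exists y => //; apply/allP => v vy.
  by rewrite ltnNge; apply/negP => yv; apply: H'; exists v => //; rewrite gdist_sym.
- by right; exists ys => //; exact: ltnW.
Qed.

Lemma reach_exit X A a b : reach e X a b -> A a -> ~ A b ->
  exists u v, [/\ e u v, A u, ~ A v, X u & X v].
Proof.
move=> ab Aa; elim: ab => [//|u v au IH uv Xv nAv].
case: (pselect (A u)) => Au; last exact: IH.
by exists u, v; split => //; exact: reach_in au.
Qed.

Lemma sumn_le (T : eqType) (s : seq T) (f : T -> nat) c :
  (forall x, x \in s -> (f x <= c)%N) -> (sumn (map f s) <= size s * c)%N.
Proof.
elim: s => //= a s IH H; rewrite mulSn leq_add ?H ?mem_head// IH// => x xs.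
by rewrite H// inE xs orbT.
Qed.

Lemma boundary_card (C : nat) (B U P : set V) : finite_set P ->
  (forall x, (setcard (nball e x 1) <= C)%N) ->
  (forall u v, e u v -> U u -> B v -> ~ U v -> P v) ->
  (setcard (edge_boundary e B U) <= setcard P * C)%N.
Proof.
move=> fP hC H.
pose s := [seq [fset y; z]%fset | y <- fset_set P, z <- fset_set (nball e y 1)].
apply: (@leq_trans (size s)).
  apply: setcard_le_seq => b [u [v [uv Uu [Bv Uv] ->]]].
  rewrite fsetUC; apply/allpairsPdep; exists v, u; split => //.
    by rewrite in_fset_set// inE; exact: H uv Uu Bv Uv.
  rewrite in_fset_set ?inE; last exact: nball_finite.
  by rewrite /nball/= gdist_sym; exact: (gdist_edge).
by rewrite size_allpairs_dep; apply: sumn_le => x _; exact: hC.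
Qed.

Lemma cover_card (C : nat) (P : set V) (ys : seq V) r :
  (forall x, (setcard (nball e x r) <= C)%N) ->
  (forall y, P y -> exists2 z, z \in ys & (d z y <= r)%N) ->
  (setcard P <= size ys * C)%N.
Proof.
move=> hC H; pose s := [seq y | z <- ys, y <- fset_set (nball e z r)].
apply: (@leq_trans (size s)).
  apply: setcard_le_seq => y /H[z zy dz]; apply/allpairsPdep; exists z, y.
  by split => //; rewrite in_fset_set ?inE//; exact: nball_finite.
by rewrite size_allpairs_dep; apply: sumn_le => x _; exact: hC.
Qed.

Variables (C D K p : nat).
Hypothesis vol : forall x r, (0 < r)%N -> (setcard (nball e x r) <= C * r ^ D)%N.
Hypothesis iso : forall x r A, (0 < r)%N -> A `<=` nball e x r ->
  (2 * setcard A <= setcard (nball e x r))%N ->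
  (setcard A <= K * setcard (edge_boundary e (nball e x r) A) ^ p)%N.

(** If no m bad points of scale n are far apart, the bad points are covered by m
    balls, hence are few. By [spread], the good points close to a region are
    bordered by bad points only: they form a large set with a small boundary.
    The sets obtained from the two regions are disjoint, as a good point is not
    close to both, so that one of them fills at most half of the ball, against
    the isoperimetric inequality. *)
Lemma cascade Cl n N m x : (0 < n)%N -> (4 * n < 2 * N)%N ->
  (m * (C * (8 * n) ^ D) + K * (m * (C * (8 * n) ^ D) * C) ^ p < N)%N ->
  bad Cl N x ->
  exists ys : seq V, [/\ size ys = m,
    forall y, y \in ys -> (d x y + 4 * n <= 4 * N)%N /\ bad Cl n y &
    pairwise (fun u v => 8 * n < d u v)%N ys].
Proof.
move=> n0 nN; set b := (m * _)%N => bN [A [A' [pA pA' AA']]].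
set B := nball e x (4 * N - 4 * n).
have fB : finite_set B by exact: nball_finite.
pose P : set V := [set y | B y /\ bad Cl n y].
have [[ys [sy Py fy]]|[ys sy cy]] := far_or_covered P (8 * n) m.
  exists ys; split => // y /Py[By by_]; split => //.
  by move: By; rewrite /B /nball/=; lia.
exfalso.
have fP : finite_set P by apply: sub_finite_set fB => y [].
have cP : (setcard P <= b)%N.
  apply: (@leq_trans (size ys * (C * (8 * n) ^ D))); last by rewrite leq_mul2r ltnW ?orbT.
  by apply: cover_card cy => y; apply: vol; lia.
have hC y : (setcard (nball e y 1) <= C)%N by have := vol y (ltn0Sn 0); rewrite exp1n muln1.
have subB y : B y -> nball e y (4 * n) `<=` nball e x (4 * N).
  move=> By u; have := gdist_triangle G x y u; move: By; rewrite /B/nball/=; lia.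
pose U (F : set V) : set V := [set y | [/\ B y, ~ P y & exists2 a, F a & (d y a <= n)%N]].
have fU F : finite_set (U F) by apply: sub_finite_set fB => y [].
have key F : region Cl N x F -> (2 * setcard (U F) <= setcard B)%N -> False.
  move=> pF h; have fF := region_finite pF; have [FB cF sF nF [a Fa xa]] := pF.
  have nF' : (n <= setcard F)%N by apply: leq_trans nF; lia.
  have UB : U F `<=` B by move=> y [].
  have r0 : (0 < 4 * N - 4 * n)%N by lia.
  have := iso r0 UB h.
  have bd : (setcard (edge_boundary e B (U F)) <= b * C)%N.
    apply: (@leq_trans (setcard P * C)); last by rewrite leq_mul2r cP orbT.
    apply: boundary_card => // u v uv [Bu Pu [c Fc uc]] Bv Uv.
    apply: contrapT => Pv; apply: Uv; split => //.
    apply: (spread n0 (subB _ Bu) cF fF sF nF' _ Fc uc uv) => // bu.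
    by apply: Pu.
  have : (N <= setcard (U F) + b)%N.
    apply: (@leq_trans (setcard (F `&` B))).
      apply: (@leq_trans (setcard (reach e (F `&` B) a))).
        by apply: comp_large => //; lia.
      apply: setcard_le; last by move=> u /reach_in.
      by apply: sub_finite_set fB => u [].
    apply: (@leq_trans (setcard (U F `|` P))).
      apply: setcard_le; first by rewrite finite_setU.
      move=> u [Fu Bu]; case: (pselect (P u)) => Pu; [by right|left].
      by split => //; exists u => //; rewrite gdistxx.
    by apply: leq_trans (setcardU_le _ _) _ => //; rewrite leq_add2l.
  have : (setcard (edge_boundary e B (U F)) ^ p <= (b * C) ^ p)%N.
    by case: (p) => [//|q]; rewrite leq_exp2r.
  rewrite -/B; move: bN; set E := (setcard (edge_boundary _ _ _) ^ p)%N; nia.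
have dU u : U A u -> ~ U A' u.
  move=> [Bu Pu [a Aa ua]] [_ _ [a' Aa' ua']]; apply: Pu; split => //.
  have pc F c : region Cl N x F -> F c -> (d u c <= n)%N ->
      region Cl n u (reach e (F `&` nball e u (4 * n)) c).
    move=> pF Fc uc; have fF := region_finite pF; have [FB cF sF nF _] := pF.
    by apply: region_piece sF _ _ _ => //; [exact: subB | lia | lia].
  exists (reach e (A `&` nball e u (4 * n)) a), (reach e (A' `&` nball e u (4 * n)) a').
  by split; [exact: pc|exact: pc|move=> v /reach_in[Av _] /reach_in[/(AA' _ Av)]].
have : (setcard (U A) + setcard (U A') <= setcard B)%N.
  have -> : (setcard (U A) + setcard (U A') = setcard (U A `|` U A'))%N.
    rewrite /setcard fset_setU // cardfsU -fset_setI //.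
    suff -> : U A `&` U A' = set0 by rewrite fset_set0 cardfs0 subn0.
    by rewrite -subset0 => u [/dU].
  by apply: setcard_le => // u [] [].
have := key _ pA; have := key _ pA'.
case: (leqP (2 * setcard (U A)) (setcard B)) => [h1 _ /(_ isT)//|h1 h2 _ h3].
apply: h2; lia.
Qed.

End Separation.

Arguments sealed {V} e Cl X A.
Arguments region {V} e Cl n x A.
Arguments bad {V} e Cl n x.

(** * Prescribed closed sets of bad balls, and the Peierls bound *)

Section Products.
Variable T : eqType.

Fixpoint concats (m : nat) (s : seq (seq T)) : seq (seq T) :=
  if m is m'.+1 then [seq F ++ H | F <- s, H <- concats m' s] else [:: [::]].

Lemma size_concats m s : size (concats m s) = (size s ^ m)%N.
Proof. by elim: m => //= m IH; rewrite size_allpairs IH expnS. Qed.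

Lemma mem_concats (I : eqType) (ys : seq I) (f : I -> seq T) s :
  (forall y, y \in ys -> f y \in s) -> flatten (map f ys) \in concats (size ys) s.
Proof.
elim: ys => [|y ys IH] H /=; first by rewrite inE.
apply/allpairsP; exists (f y, flatten (map f ys)); split => //=.
  by apply: H; rewrite mem_head.
by apply: IH => z zy; apply: H; rewrite inE zy orbT.
Qed.

End Products.

Section Families.
Context {V : choiceType} {e : rel V} {G : infinite_graph e}.
Variables (C D K p : nat).
Hypothesis vol : forall x r, (0 < r)%N -> (setcard (nball e x r) <= C * r ^ D)%N.
Hypothesis iso : forall x r (A : set V), (0 < r)%N -> A `<=` nball e x r ->
  (2 * setcard A <= setcard (nball e x r))%N ->
  (setcard A <= K * setcard (edge_boundary e (nball e x r) A) ^ p)%N.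
Hypotheses (C0 : (0 < C)%N) (D0 : (0 < D)%N) (p0 : (0 < p)%N).

Local Notation d := (gdist e).

(* Scales are nn k = n0 ^ (g ^ k). As g > D p, the next scale dominates the p-th
   power of the volume of boundedly many balls of radius 8 nn k. A scale k has at
   most Q ^ (g ^ k) positions, which m ^ k closed vertices outweigh as m > g. *)
Let g := (D * p + 1)%N.
Let m := (2 * g)%N.
Let n0 := (m * (C * 8 ^ D) + K * (m * (C * 8 ^ D) * C) ^ p + 3)%N.
Let nn k := (n0 ^ (g ^ k))%N.
Let Q := (C * 4 ^ D * n0 ^ (g * D))%N.

Let g2 : (2 <= g)%N. Proof. rewrite /g; nia. Qed.
Let m0 : (0 < m)%N. Proof. by rewrite /m /g; lia. Qed.
Let n03 : (3 <= n0)%N. Proof. by rewrite /n0 leq_addl. Qed.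
Let nnS k : nn k.+1 = (nn k ^ g)%N. Proof. by rewrite /nn expnSr expnM. Qed.
Let nn_ge k : (n0 <= nn k)%N.
Proof. by rewrite -{1}(expn1 n0) leq_exp2l ?expn_gt0; lia. Qed.

Let nn_step k : (4 * nn k < 2 * nn k.+1)%N.
Proof.
rewrite nnS; apply: (@leq_trans (2 * nn k ^ 2)).
  by have := nn_ge k; have := n03; nia.
by rewrite leq_mul2l /= leq_exp2l //; have := nn_ge k; have := n03; lia.
Qed.

Let nn_iso k : (m * (C * (8 * nn k) ^ D) +
  K * (m * (C * (8 * nn k) ^ D) * C) ^ p < nn k.+1)%N.
Proof.
set b := (m * (C * (8 * nn k) ^ D))%N; set n := nn k; have n1 : (n0 <= n)%N := nn_ge k.
have npos : (0 < n)%N by have := n03; lia.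
have eb : (b = m * (C * 8 ^ D) * n ^ D)%N by rewrite /b expnMn -/n; ring.
have -> : (nn k.+1 = n * n ^ (D * p))%N by rewrite nnS /g addn1 expnS.
have np : (n ^ D <= n ^ (D * p))%N.
  by rewrite leq_exp2l ?leq_pmulr//; have := n03; lia.
have -> : ((b * C) ^ p = (m * (C * 8 ^ D) * C) ^ p * n ^ (D * p))%N.
  by rewrite eb mulnAC expnMn -expnM.
rewrite eb; move: n1; rewrite /n0.
set c1 := (m * (C * 8 ^ D))%N; set c2 := ((c1 * C) ^ p)%N.
have : (0 < n ^ (D * p))%N by rewrite expn_gt0 npos.
move: np; set a := (n ^ D)%N; set z := (n ^ (D * p))%N => az z0 nc.
have h1 : (c1 * a <= c1 * z)%N by rewrite leq_mul2l az orbT.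
have : ((c1 + K * c2 + 3) * z <= n * z)%N by rewrite leq_mul2r nc orbT.
by rewrite !mulnDl -mulnA; lia.
Qed.

Let volQ x k : (setcard (nball e x (4 * nn k.+1)) <= Q ^ (g ^ k))%N.
Proof.
apply: leq_trans (vol x _) _; first by rewrite muln_gt0 expn_gt0; have := n03; lia.
rewrite /Q expnMn mulnA expnMn leq_mul //.
  by rewrite -{1}(expn1 (C * 4 ^ D)) leq_pexp2l ?muln_gt0 ?expn_gt0 ?C0//; lia.
by rewrite nnS /nn -!expnM -mulnA mulnC mulnA.
Qed.

Let Q0 : (0 < Q)%N.
Proof. by rewrite !muln_gt0 C0 !expn_gt0 /=; have := n03; lia. Qed.

Let sizes k : (2 * g ^ k <= 3 * m ^ k)%N.
Proof. by rewrite /m expnMn leq_mul // leq_pmull // expn_gt0. Qed.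

Lemma bad_closed Cl n x : bad e Cl n x -> exists2 u, (d x u <= 4 * n)%N & Cl u.
Proof.
move=> [A [A' [[AB _ sA _ [a Aa _]] [A'B _ _ _ [a' Aa' _]] dis]]].
have aa' := nball_connected_in (G := G) (AB _ Aa) (A'B _ Aa').
have [|u [v [uv Au nAv Bu Bv]]] := reach_exit aa' Aa; first by move=> /dis; apply.
by have [] := sA _ _ uv Au Bv nAv; [exists u | exists v].
Qed.

Lemma flatten_uniq (f : V -> seq V) n (ys : seq V) :
  (forall y, y \in ys -> uniq (f y)) ->
  (forall y u, y \in ys -> u \in f y -> (d y u <= 4 * n)%N) ->
  pairwise (fun u v => 8 * n < d u v)%N ys -> uniq (flatten (map f ys)).
Proof.
elim: ys => //= y ys IH uf fB /andP[fy fys]; rewrite cat_uniq uf ?mem_head//=.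
rewrite IH ?andbT//; first last.
- by move=> z u zy; apply: fB; rewrite inE zy orbT.
- by move=> z zy; apply: uf; rewrite inE zy orbT.
apply/hasPn => u /flatten_mapP[z zy uz]; apply/negP => uy.
have := allP fy _ zy; have := fB y u (mem_head _ _) uy.
have : (d z u <= 4 * n)%N by apply: fB => //; rewrite inE zy orbT.
by have := gdist_triangle G y u z; rewrite (gdist_sym u z); lia.
Qed.

(** The bound on the size is the solution N k of the recursion
    N (k + 1) = (Q ^ (g ^ k) * N k) ^ m with N 0 = Q. The m sub-events live in
    disjoint balls, so that the union of their sets has m ^ (k + 1) elements. *)
Lemma bad_family k x : exists fam : seq (seq V),
  [/\ (size fam <= Q ^ (3 * m ^ k - 2 * g ^ k))%N,
      forall F, F \in fam -> [/\ uniq F, size F = (m ^ k)%N &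
        forall u, u \in F -> (d x u <= 4 * nn k)%N] &
      forall Cl, bad e Cl (nn k) x -> exists2 F, F \in fam & all Cl F].
Proof.
elim: k x => [|k IH] x.
  have fB : finite_set (nball e x (4 * nn 0)) by exact: nball_finite.
  exists [seq [:: u] | u <- fset_set (nball e x (4 * nn 0))]; split.
  - rewrite size_map -[size _]/(setcard _) !expn0 !muln1 (_ : 3 - 2 = 1)%N// expn1.
    apply: (@leq_trans (Q ^ (g ^ 0))); last by rewrite expn0 expn1.
    apply: leq_trans (volQ x 0).
    apply: setcard_le; first exact: nball_finite.
    by apply: nball_mono; have := nn_step 0; lia.
  - move=> F /mapP[u]; rewrite in_fset_set// inE => Bu ->; split => // v.
    by rewrite inE => /eqP ->.
  - move=> Cl /bad_closed[u xu Cu]; exists [:: u]; last by rewrite /= Cu.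
    by apply: map_f; rewrite in_fset_set// inE.
have [fam famP] := choice IH.
set N := nn k.+1; have fB : finite_set (nball e x (4 * N)) by exact: nball_finite.
pose H := flatten [seq fam y | y <- fset_set (nball e x (4 * N))].
pose ok (F : seq V) := [&& uniq F, size F == (m ^ k.+1)%N & all (fun u => d x u <= 4 * N)%N F].
exists [seq F <- concats m H | ok F]; split.
- rewrite size_filter (leq_trans (count_size _ _))// size_concats.
  have sH : (size H <= Q ^ (g ^ k) * Q ^ (3 * m ^ k - 2 * g ^ k))%N.
    rewrite size_flatten /shape -map_comp; apply: leq_trans (sumn_le (c := (Q ^ (3 * m ^ k - 2 * g ^ k))%N) _) _.
      by move=> y _; have [] := famP y.
    by rewrite leq_mul2r -[size _]/(setcard _) volQ orbT.
  apply: (@leq_trans ((Q ^ (g ^ k) * Q ^ (3 * m ^ k - 2 * g ^ k)) ^ m)).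
    by rewrite leq_exp2r ?m0.
  rewrite -expnD -expnM leq_pexp2l // !expnS.
  have := sizes k; rewrite {3 4}/m; nia.
- move=> F; rewrite mem_filter => /andP[/and3P[uF /eqP sF /allP FB] _].
  by split.
- move=> Cl /(cascade vol iso _ (nn_step k) (nn_iso k)).
  have nk0 : (0 < nn k)%N by have := nn_ge k; have := n03; lia.
  move=> /(_ nk0) [ys [sys ysP far]].
  have /choice[f fP] : forall y, exists F, y \in ys -> F \in fam y /\ all Cl F.
    move=> y; case: (boolP (y \in ys)) => [yy|_]; last by exists [::].
    have [_ /(let: And3 _ _ h := famP y in h)[F Ff CF]] := ysP _ yy.
    by exists F.
  have fB' y u : y \in ys -> u \in f y -> (d y u <= 4 * nn k)%N.
    by move=> yy; have [ff _] := fP _ yy; have [_ /(_ _ ff)[_ _ h] _] := famP y; exact: h.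
  exists (flatten (map f ys)); last first.
    by apply/allP => u /flatten_mapP[y yy]; have [_ /allP] := fP _ yy; apply.
  rewrite mem_filter; apply/andP; split.
    apply/and3P; split.
    + apply: flatten_uniq fB' far => y yy.
      by have [ff _] := fP _ yy; have [_ /(_ _ ff)[]] := famP y.
    + rewrite size_flatten /shape -map_comp expnS -{1}sys.
      apply/eqP; elim: (ys) (fP) => //= y zs IHz h; rewrite IHz.
        rewrite mulSn; congr addn.
        have [ff _] := h _ (mem_head _ _).
        by have [_ /(_ _ ff)[]] := famP y.
      by move=> z zz; apply: h; rewrite inE zz orbT.
    + apply/allP => u /flatten_mapP[y yy uy].
      have [xy _] := ysP _ yy; have := fB' _ _ yy uy.
      by have := gdist_triangle G x y u; rewrite -/N in xy *; lia.
  rewrite -sys; apply: mem_concats => y yy; apply/flatten_mapP; exists y.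
    rewrite in_fset_set// inE /nball/=; have [xy _] := ysP _ yy.
    by rewrite -/N in xy; lia.
  by have [] := fP _ yy.
Qed.

(** If all points were good, a sealed set with nn k elements would by [spread] be
    close to every point of the ball of radius 4 * nn k.+1 around o, hence reach
    distance nn k.+1 and have nn k.+1 elements. Induction on k contradicts
    finiteness. A set with less than n0 elements has a boundary edge, hence a
    closed vertex, in the ball of radius n0. *)
Lemma sealed_bad Cl o (A : set V) : finite_set A -> connected_in e A -> A o ->
  sealed e Cl [set: V] A ->
  (exists2 u, (d o u <= n0)%N & Cl u) \/
  exists k y, (d o y <= 4 * nn k.+1)%N /\ bad e Cl (nn k) y.
Proof.
move=> fA cA Ao sA.
case: (leqP n0 (setcard A)) => cn; last first.
  left; have [b Bb nAb] : exists2 b, nball e o n0 b & ~ A b.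
    apply: contrapT => h; have : (n0.+1 <= setcard A)%N; last by lia.
    apply: leq_trans (nball_large (G := G) o n0) _; apply: setcard_le => // b Bb.
    by apply: contrapT => nAb; apply: h; exists b.
  have [u [v [uv Au nAv Bu Bv]]] := reach_exit (ball_connected (G := G) Bb) Ao nAb.
  by have [] := sA _ _ uv Au I nAv; [exists u | exists v].
right; apply: contrapT => H.
have good k y : (d o y <= 4 * nn k.+1)%N -> ~ bad e Cl (nn k) y.
  by move=> oy by_; apply: H; exists k, y.
(* the scales exceed the cardinality of A *)
suff big k : (nn k <= setcard A)%N.
  have := big (setcard A); rewrite leqNgt => /negP; apply.
  apply: (@ltn_trans (g ^ setcard A)); apply: ltn_expl; have := n03; lia.
elim: k => [|k IH]; first by rewrite /nn expn0 expn1.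
have nk0 : (0 < nn k)%N by have := nn_ge k; have := n03; lia.
have near y : reach e (nball e o (4 * nn k.+1)) o y ->
    exists2 a, A a & (d y a <= nn k)%N.
  elim=> [_|z y' oy [a Aa za] zy' _]; first by exists o; rewrite // gdistxx.
  apply: (spread nk0 _ cA fA sA IH _ Aa za zy') => //.
  by apply: good; exact: reach_in oy.
have [u ou] := exists_level (G := G) o (4 * nn k.+1).
have /(ball_connected (G := G))/near[a Aa ua] : nball e o (4 * nn k.+1) u.
  by rewrite /nball/= ou.
have oa : (nn k.+1 <= d o a)%N.
  have := gdist_triangle G o a u; rewrite (gdist_sym a u) ou.
  by have := nn_step k; lia.
apply: (levels_card (e := e) (y := o) (i := 0) fA) => j jn.
have oo : (d o o <= d o a)%N by rewrite gdistxx.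
have [[_ h]|h] := reach_levels (G := G) (cA _ _ Ao Aa) oo;
  by have [|v /reach_in[Av _] dv] := h j; [rewrite gdistxx; lia | exists v].
Qed.

(** The counting behind Peierls' argument: M ^ s sets of size s are summable
    against eps ^ s for small eps, since s grows with the index k. *)
Lemma peierls_families : exists2 M : nat, (0 < M)%N & forall o : V,
  exists fam : nat -> seq (seq V), (forall k, exists2 s,
    (k.+1 <= 2 * s)%N /\ (size (fam k) <= M ^ s)%N &
    forall F, F \in fam k -> uniq F /\ size F = s) /\
  (forall Cl (A : set V), finite_set A -> connected_in e A -> A o ->
    sealed e Cl [set: V] A -> exists k F, F \in fam k /\ all Cl F).
Proof.
exists (Q ^ 3)%N; first by rewrite expn_gt0 Q0.
move=> o.
have /choice[fam famP] : forall ky : nat * V, exists fam : seq (seq V),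
  [/\ (size fam <= Q ^ (3 * m ^ ky.1 - 2 * g ^ ky.1))%N,
      forall F, F \in fam -> uniq F /\ size F = (m ^ ky.1)%N &
      forall Cl, bad e Cl (nn ky.1) ky.2 -> exists2 F, F \in fam & all Cl F].
  move=> [k y]; have [fam [h1 h2 h3]] := bad_family k y.
  by exists fam; split => // F /h2[].
have fB r : finite_set (nball e o r) by exact: nball_finite.
exists (fun k => if k is k'.+1
  then flatten [seq fam (k', y) | y <- fset_set (nball e o (4 * nn k'.+1))]
  else [seq [:: u] | u <- fset_set (nball e o n0)]); split.
- case=> [|k].
    exists 1%N => [|F /mapP[u _ ->]//]; split => //.
    rewrite size_map -[size _]/(setcard _) expn1.
    apply: (@leq_trans (Q ^ (g ^ 0))); last by rewrite leq_pexp2l.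
    apply: leq_trans (volQ o 0); apply: setcard_le; first exact: nball_finite.
    by apply: nball_mono; have := nn_step 0; have := nn_ge 0; lia.
  exists (m ^ k)%N.
    split; first by have : (k < m ^ k)%N by [apply: ltn_expl; rewrite /m; lia]; lia.
    rewrite size_flatten /shape -map_comp; apply: leq_trans (sumn_le (c := (Q ^ (3 * m ^ k - 2 * g ^ k))%N) _) _.
      by move=> y _; have [] := famP (k, y).
    rewrite -[size _]/(setcard _).
    apply: (@leq_trans (Q ^ (g ^ k) * Q ^ (3 * m ^ k - 2 * g ^ k))).
      by rewrite leq_mul2r volQ orbT.
    by rewrite -expnD -expnM leq_pexp2l //; have := sizes k; lia.
  by move=> F /flatten_mapP[y _ Fy]; have [_ /(_ _ Fy)] := famP (k, y).
- move=> Cl A fA cA Ao sA; have [[u ou Cu]|[k [y [oy by_]]]] := sealed_bad fA cA Ao sA.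
    exists 0%N, [:: u]; rewrite /= Cu; split => //; apply: map_f.
    by rewrite in_fset_set// inE.
  have [_ _ /(_ Cl by_)[F Ff CF]] := famP (k, y).
  exists k.+1, F; split => //; apply/flatten_mapP; exists y => //.
  by rewrite in_fset_set// inE.
Qed.

End Families.

Section Peierls.
Context {V : choiceType} {e : rel V} {G : infinite_graph e}.
Variable R : realType.

(** The weights W need not come from a product measure: the only input is the
    probability that a given set of vertices is closed. *)
Definition peierls_bound (eps : R) := forall (o : V) (T : finType) (W : T -> R)
  (Cl : T -> pred V), (forall t, 0 <= W t) ->
  (forall Z : seq V, uniq Z ->
     \sum_(t | all (Cl t) Z) W t <= eps ^+ size Z * \sum_t W t) ->
  \sum_(t | `[< exists A : set V, [/\ finite_set A, connected_in e A, A o &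
                  sealed e (Cl t) [set: V] A] >]) W t <= 4^-1 * \sum_t W t.

Lemma sum_union (T : finType) (I : Type) (s : seq I) (W : T -> R)
    (P : pred T) (B : I -> pred T) : (forall t, 0 <= W t) ->
  (forall t, P t -> has (B^~ t) s) ->
  \sum_(t | P t) W t <= \sum_(i <- s) \sum_(t | B i t) W t.
Proof.
move=> W0 PB; under [leRHS]eq_bigr do rewrite big_mkcond; rewrite [leRHS]exchange_big /=.
rewrite big_mkcond; apply: ler_sum => t _; case: ifPn => [/PB|_]; last first.
  by apply: sumr_ge0 => i _; case: ifP.
elim: s {PB} => //= i s IH /orP[Bi|/IH h]; rewrite big_cons.
  by rewrite Bi lerDl sumr_ge0 // => j _; case: ifP.
by rewrite -[leLHS]add0r lerD //; case: ifP.
Qed.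

Lemma peierls (M : nat) : (0 < M)%N ->
  (forall o : V,
  exists fam : nat -> seq (seq V), (forall k, exists2 s,
    (k.+1 <= 2 * s)%N /\ (size (fam k) <= M ^ s)%N &
    forall F, F \in fam k -> uniq F /\ size F = s) /\
  (forall Cl (A : set V), finite_set A -> connected_in e A -> A o ->
    sealed e Cl [set: V] A -> exists k F, F \in fam k /\ all Cl F)) ->
  peierls_bound (64 * M%:R)^-1.
Proof.
move=> M0 H o T W Cl W0 hZ; have [fam [famS famP]] := H o.
set eps := (64 * M%:R)^-1 in hZ *; set Z := \sum_t W t in hZ *.
set P := (X in \sum_(t | X t) _ <= _).
have Z0 : 0 <= Z by apply: sumr_ge0.
have /choice[kt ktP] : forall t, exists k, P t -> has (all (Cl t)) (fam k).
  move=> t; case: (pselect (P t)) => [Pt|nPt]; last by exists 0%N => /nPt.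
  have /asboolP[A [fA cA Ao sA]] := Pt; have [k [F [Fk CF]]] := famP _ _ fA cA Ao sA.
  by exists k => _; apply/hasP; exists F.
pose Kmax := (\max_t kt t).+1.
apply: (@le_trans _ _ (\sum_(k <- iota 0 Kmax) \sum_(t | has (all (Cl t)) (fam k)) W t)).
  apply: sum_union => // t /ktP h; apply/hasP; exists (kt t) => //.
  by rewrite mem_iota /= add0n ltnS leq_bigmax.
(* eps M = 8 ^- 2 and k + 1 <= 2 s, so that the sets of index k contribute at
   most 8 ^- (k + 1) *)
have bk k : \sum_(t | has (all (Cl t)) (fam k)) W t <= 4^-1 * 2^-1 ^+ k.+1 * Z.
  have [s [ks sM] famk] := famS k.
  apply: (@le_trans _ _ (\sum_(F <- fam k) \sum_(t | all (Cl t) F) W t)).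
    by apply: sum_union.
  apply: (@le_trans _ _ (\sum_(F <- fam k) eps ^+ s * Z)).
    rewrite big_seq [leRHS]big_seq; apply: ler_sum => F /famk[uF <-]; exact: hZ.
  rewrite big_const_seq count_predT iter_addr_0 -mulrnAl. 
  apply: ler_wpM2r => //.
  have M0' : 0 < M%:R :> R by rewrite ltr0n.
  apply: (@le_trans _ _ ((M ^ s)%:R * eps ^+ s)).
    by rewrite -mulr_natl; apply: ler_wpM2r; [rewrite exprn_ge0 // invr_ge0; lra | rewrite ler_nat].
  rewrite natrX -exprMn (_ : M%:R * eps = 8^-1 ^+ 2); last first.
    by rewrite /eps; field; rewrite gt_eqF.
  rewrite -exprM; apply: (@le_trans _ _ (8^-1 ^+ k.+1)).
    by apply: ler_wiXn2l; rewrite ?invr_ge0 ?invf_le1 // ?ler1n.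
  rewrite (_ : 8^-1 = 4^-1 * 2^-1) ?exprMn; last by field.
  apply: ler_wpM2r; first by rewrite exprn_ge0.
  by rewrite -[leRHS]expr1; apply: ler_wiXn2l => //; rewrite invf_le1 // ler1n.
apply: (@le_trans _ _ (\sum_(k <- iota 0 Kmax) 4^-1 * 2^-1 ^+ k.+1 * Z)).
  by apply: ler_sum => k _.
rewrite -mulr_suml -mulr_sumr; apply: ler_wpM2r => //.
rewrite -[leRHS]mulr1; apply: ler_wpM2l; first by rewrite invr_ge0.
have -> : iota 0 Kmax = index_iota 0 Kmax by rewrite /index_iota subn0.
suff -> : \sum_(0 <= k < Kmax) (2^-1 : R) ^+ k.+1 = 1 - 2^-1 ^+ Kmax.
  by rewrite gerBl exprn_ge0 // invr_ge0.
elim: (Kmax) => [|q IH]; first by rewrite big_geq // expr0 subrr.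
by rewrite big_nat_recr //= IH exprS; field.
Qed.

End Peierls.
Arguments peierls_bound {V} e {R} eps.

(** * Growth hypotheses in natural numbers *)

Section Hypotheses.
Variables (R : realType) (V : choiceType) (e : rel V).

Lemma gball_nball x n : gball e x (n%:R : R) = nball e x n.
Proof. by apply/seteqP; split => y; rewrite /gball /nball /= ler_nat. Qed.

Lemma volume_nat (d c : R) : 0 < c -> volume_upper_bound e d c ->
  exists C D : nat, [/\ (0 < C)%N, (0 < D)%N &
    forall x r, (0 < r)%N -> (setcard (nball e x r) <= C * r ^ D)%N].
Proof.
move=> c0 hV; exists (Num.bound c), (Num.bound `|d|).+1; split => //.
move=> x r r0; rewrite -gball_nball -(ler_nat R).
have r1 : 1 <= r%:R :> R by rewrite ler1n.
apply: le_trans (hV x r%:R r1) _; rewrite natrM natrX.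
apply: ler_pM; [exact: ltW|exact: powR_ge0|exact/ltW/archi_boundP/ltW|].
rewrite -powR_mulrn ?ler0n//; apply: ler_powR => //.
apply: (le_trans (ler_norm d)); apply: (@le_trans _ _ (Num.bound `|d|)%:R).
  exact/ltW/archi_boundP.
by rewrite ler_nat.
Qed.

(** The exponent (d - 1) / d is at least 1 / p for some p, and lowering the
    exponent weakens the inequality since a nonempty set has at least one point. *)
Lemma isoperimetric_nat (d c : R) : 1 < d -> 0 < c -> local_isoperimetric e d c ->
  exists K p : nat, (0 < p)%N /\
    forall x r (A : set V), (0 < r)%N -> A `<=` nball e x r ->
    (2 * setcard A <= setcard (nball e x r))%N ->
    (setcard A <= K * setcard (edge_boundary e (nball e x r) A) ^ p)%N.
Proof.
move=> d1 c0 hL; set al := (d - 1) / d.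
have al0 : 0 < al by rewrite divr_gt0; lra.
pose p := (Num.bound al^-1).+1.
have pal : (p%:R : R)^-1 <= al.
  rewrite -[leRHS]invrK lef_pV2 ?posrE ?invr_gt0 ?ltr0n//.
  apply: (@le_trans _ _ (Num.bound al^-1)%:R); last by rewrite ler_nat.
  by apply/ltW/archi_boundP; rewrite invr_ge0 ltW.
exists (Num.bound (c ^- p)), p; split => // x r A r0 AB hA.
rewrite -gball_nball in AB *; rewrite -gball_nball in hA.
have r1 : 1 <= r%:R :> R by rewrite ler1n.
have hA' : (setcard A)%:R <= (setcard (gball e x (r%:R : R)))%:R / 2 :> R.
  by rewrite ler_pdivlMr// mulrC -natrM ler_nat.
have := hL x r%:R r1 A AB hA'; set b := setcard (edge_boundary _ _ _).
case: (posnP (setcard A)) => [-> //|A0].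
have A1 : 1 <= (setcard A)%:R :> R by rewrite ler1n.
move=> h; have : (c * (setcard A)%:R `^ p%:R^-1) ^+ p <= b%:R ^+ p :> R.
  apply: lerXn2r; rewrite ?nnegrE ?ler0n ?mulr_ge0 ?powR_ge0 ?(ltW c0)//.
  by apply: le_trans h; rewrite ler_pM2l//; apply: ler_powR.
rewrite exprMn -(powR_mulrn p (powR_ge0 _ _)) -powRrM mulVf ?pnatr_eq0// powRr1//.
rewrite -ler_pdivlMl ?exprn_gt0// => h2.
rewrite -(ler_nat R) natrM natrX; apply: (le_trans h2).
apply: ler_wpM2r; first by rewrite exprn_ge0.
by apply/ltW/archi_boundP; rewrite invr_ge0 exprn_ge0// ltW.
Qed.

(** The degree bound is the volume bound at radius 1. *)
Lemma peierls_exists (d_i d_u c_i c_u : R) : infinite_graph e ->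
  1 < d_i -> 0 < c_i -> 0 < c_u ->
  local_isoperimetric e d_i c_i -> volume_upper_bound e d_u c_u ->
  (exists eps : R, [/\ 0 < eps, eps <= 8^-1 & peierls_bound e eps]) /\
  exists D : nat, forall x, (setcard [set y | e x y] <= D)%N.
Proof.
move=> G di ci cu hL hV; have [C [D [C0 D0 vol]]] := volume_nat cu hV.
have [K [p [p0 iso]]] := isoperimetric_nat di ci hL.
split; last first.
  exists C => x; have := vol x _ (ltn0Sn 0); rewrite exp1n muln1; apply: leq_trans.
  by apply: setcard_le => [|y /gdist_edge//]; exact: nball_finite.
have [M M0 h] := peierls_families vol iso C0 D0 p0.
have M1 : 1 <= M%:R :> R by rewrite ler1n.
exists (64 * M%:R)^-1; split; last exact: peierls.
  by rewrite invr_gt0; lra.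
by rewrite lef_pV2 ?posrE; lra.
Qed.

End Hypotheses.

(** * Realizing a finitely additive probability on cylinders *)

Section FinitelyAdditive.
Variables (R : realType) (Om : Type).

Record fin_additive (E : set Om -> R) : Prop := FinAdditive {
  faT : E setT = 1;
  fa_ge0 : forall A, 0 <= E A;
  faU : forall A B, A `&` B = set0 -> E (A `|` B) = E A + E B }.

Variable E : set Om -> R.
Hypothesis faE : fin_additive E.

Lemma fa0 : E set0 = 0.
Proof.
have := faU faE (setI0 (set0 : set Om)); rewrite setU0 => /eqP.
by rewrite -subr_eq subrr eq_sym => /eqP.
Qed.

Lemma fa_sum (T : finType) (f : Om -> T) A :
  E A = \sum_(t : T) E (A `&` [set w | f w = t]).
Proof.
have H (s : seq T) : uniq s ->
    E (A `&` [set w | f w \in s]) = \sum_(t <- s) E (A `&` [set w | f w = t]).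
  elim: s => [_|t s IH /= /andP[ts us]].
    rewrite big_nil -[RHS]fa0; congr E; rewrite -subset0 => w [_ /=].
    by rewrite in_nil.
  rewrite big_cons -IH // -(faU faE); last first.
    by rewrite -subset0 => w [[_ /= ft] [_ /=]]; rewrite ft; exact/negP.
  congr E; apply/seteqP; split => w.
    by move=> [Aw /=]; rewrite inE => /predU1P[|]; [left|right].
  by move=> [[Aw /= ft]|[Aw /= ws]]; split; rewrite //= inE ?ft ?eqxx ?ws ?orbT.
rewrite -H ?index_enum_uniq //; congr E; apply/seteqP; split => w //; last by case.
by move=> Aw; split; rewrite //= mem_index_enum.
Qed.

End FinitelyAdditive.

Section Subdivision.
Variables (R : realType) (S : finPointedType) (q : seq S -> R).
Hypotheses (q0 : forall w, 0 <= q w) (q1 : q [::] = 1)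
  (qS : forall w, q w = \sum_s q (s :: w)).

Fixpoint lo (w : seq S) : R :=
  if w is s :: w' then lo w' + \sum_(t <- take (index s (enum S)) (enum S)) q (t :: w')
  else 0.

(** The unit interval is cut into intervals of lengths q [:: s], each of them is
    cut again, and so on. The cell of a word is the interval that it addresses;
    words are written backwards, the latest letter first. *)
Definition cell w (u : R) := lo w <= u < lo w + q w.

Lemma sum_cell (s : seq S) (f : S -> R) c u : uniq s ->
  c <= u < c + \sum_(x <- s) f x ->
  exists2 x, x \in s & let c' := c + \sum_(t <- take (index x s) s) f t in
    c' <= u < c' + f x.
Proof.
elim: s c => [|a s IH] c /=; first by rewrite big_nil addr0 => _ /andP[h1 h2]; lra.
rewrite big_cons addrA => /andP[nas us] /andP[cu uc].
have [ua|au] := ltP u (c + f a).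
  by exists a; rewrite ?mem_head //= eqxx big_nil addr0 cu ua.
have [|x xs h] := IH (c + f a) us; first by rewrite au uc.
exists x; first by rewrite inE xs orbT.
have -> : a == x = false by apply: contraNF nas => /eqP ->.
by rewrite big_cons addrA.
Qed.

Lemma sum_cell_inj (s : seq S) (f : S -> R) c u x y : (forall t, 0 <= f t) ->
  x \in s -> y \in s ->
  let c' t := c + \sum_(t <- take (index t s) s) f t in
  c' x <= u < c' x + f x -> c' y <= u < c' y + f y -> x = y.
Proof.
move=> f0; elim: s c => //= a s IH c.
have far t : c + \sum_(t <- a :: take (index t s) s) f t <= u -> ~ u < c + f a.
  have : 0 <= \sum_(t <- take (index t s) s) f t by apply: sumr_ge0.
  by rewrite big_cons addrA; lra.
rewrite !inE [x == a]eq_sym [y == a]eq_sym.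
case: eqP => [<- _|_ /= xs]; case: eqP => [<- _|_ /= ys] //=.
- by rewrite big_nil addr0 => /andP[_ h] /andP[/far].
- by rewrite [in X in _ -> X -> _]big_nil addr0 => /andP[/far h _] /andP[_ /h].
- by rewrite !big_cons !addrA; exact: IH.
Qed.

Lemma cell_sub s w u : cell (s :: w) u -> cell w u.
Proof.
rewrite /cell /= => /andP[h1 h2]; apply/andP; split.
  by apply: le_trans h1; rewrite lerDl sumr_ge0.
apply: (lt_le_trans h2); rewrite -addrA lerD2l (qS w).
rewrite -[leRHS]big_enum /=; set l := enum S.
have sl : s \in l by rewrite mem_enum.
rewrite -[in leRHS](cat_take_drop (index s l) l) big_cat lerD2l.
by rewrite (drop_nth s) ?index_mem // nth_index // big_cons lerDl sumr_ge0.
Qed.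

Lemma cell_split w u : cell w u -> exists s, cell (s :: w) u.
Proof.
rewrite /cell qS -big_enum /= => h.
by have [s _ hs] := sum_cell (enum_uniq S) h; exists s.
Qed.

Lemma cell_inj s t w u : cell (s :: w) u -> cell (t :: w) u -> s = t.
Proof.
rewrite /cell /=; apply: (sum_cell_inj (f := fun t => q (t :: w))) => //.
- by rewrite mem_enum.
- by rewrite mem_enum.
Qed.

Lemma cell_nil u : cell [::] u = (0 <= u < 1).
Proof. by rewrite /cell /= q1 add0r. Qed.

(** The address of u; its letters have joint law q when u is uniform. *)
Fixpoint word (n : nat) (u : R) : seq S :=
  if n is n'.+1 then odflt point [pick s | cell (s :: word n' u) u] :: word n' u
  else [::].

Lemma size_word n u : size (word n u) = n.
Proof. by elim: n => //= n ->. Qed.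

Lemma wordP u w : 0 <= u < 1 -> (word (size w) u == w) = cell w u.
Proof.
move=> u01; elim: w => [|s w IH] /=; first by rewrite cell_nil eqxx.
rewrite eqseq_cons IH; case: (boolP (cell w u)) => [cw|ncw]; last first.
  by rewrite andbF; apply/esym; apply: contraNF ncw => /cell_sub.
have /eqP -> : word (size w) u == w by rewrite IH.
rewrite andbT; case: pickP => [t ct /=|h]; last by have [t] := cell_split cw; rewrite h.
by apply/eqP/idP => [<- //|cs]; exact: cell_inj ct cs.
Qed.

Definition letter (i : nat) (u : R) : S :=
  if 0 <= u < 1 then head point (word i.+1 u) else point.

Lemma nth_word n u i : 0 <= u < 1 -> (i < n)%N ->
  nth point (rev (word n u)) i = letter i u.
Proof.
move=> u01; rewrite /letter u01; elim: n => // n IH; rewrite ltnS /= rev_cons nth_rcons.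
rewrite size_rev size_word leq_eqVlt => /predU1P[->|ni]; last by rewrite ni IH.
by rewrite ltnn eqxx.
Qed.

Lemma word_set n (A : set (seq S)) : 
  [set u | 0 <= u < 1 /\ A (word n u)] =
  \bigcup_(t in [set t : n.-tuple S | A t]) [set` `[lo t, (lo t + q t)[ ].
Proof.
have itvE (t : n.-tuple S) u : [set` `[lo t, (lo t + q t)[ ] u <-> cell t u.
  by rewrite /= in_itv.
apply/seteqP; split => [u [u01 Au]|u [t At /itvE ct]].
  have sw : size (word n u) == n by rewrite size_word.
  exists (Tuple sw) => //; apply/itvE => /=.
  by rewrite -wordP // size_word.
have u01 : 0 <= u < 1.
  by rewrite -cell_nil; elim: (tval t) ct => // s w IH /cell_sub.
split => //; suff -> : word n u = t by [].
by apply/eqP; rewrite -[X in word X u](size_tuple t) wordP.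
Qed.

Lemma measurable_word n (A : set (seq S)) :
  measurable ([set u | 0 <= u < 1 /\ A (word n u)] : set R).
Proof. by rewrite word_set; apply: fin_bigcup_measurable. Qed.

Lemma lebesgue_word n (A : set (seq S)) :
  lebesgue_measure ([set u | 0 <= u < 1 /\ A (word n u)] : set R) =
  (\sum_(t : n.-tuple S | `[< A t >]) q t)%:E.
Proof.
rewrite word_set measure_fin_bigcup //=; last first.
  apply/trivIsetP => t t' _ _ tt'; rewrite -subset0 => u [].
  rewrite /= !in_itv /= => h h'; apply: (negP tt'); apply/eqP/val_inj => /=.
  have u01 : 0 <= u < 1.
    by rewrite -cell_nil; elim: (tval t) (h : cell t u) => // s w IH /cell_sub.
  have /eqP <- : word n u == t by rewrite -[X in word X u](size_tuple t) wordP.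
  by apply/eqP; rewrite -[X in word X u](size_tuple t') wordP.
have -> : [set t : n.-tuple S | A t] = [set` [pred t : n.-tuple S | `[< A t >]]].
  by apply/seteqP; split => t /= At; apply/asboolP.
rewrite -(@bigfs _ _ _ _ (index_enum _)) ?index_enum_uniq //; last first.
  by move=> t _; rewrite mem_index_enum.
rewrite -sumEFin; apply: eq_bigr => t _.
rewrite lebesgue_measure_itv /= lte_fin ltrDl.
have [_|qt] := ltP 0 (q t); first by rewrite -EFinB addrC addKr.
by congr EFin; apply/eqP; rewrite eq_le qt q0.
Qed.

End Subdivision.

Section Extension.
Variables (R : realType) (V : choiceType) (S : finPointedType).
Variables (iota_ : V -> nat) (v : nat -> V).
Hypothesis iotaK : cancel iota_ v.
Variable E : set (V -> S) -> R.
Hypothesis faE : fin_additive E.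

Definition local_on (W : {fset V}) (A : set (V -> S)) := forall s s' : V -> S,
  (forall x, x \in W -> s x = s' x) -> A s -> A s'.

Let prefix_rev n (s : V -> S) : seq S := rev [seq s (v i) | i <- iota 0 n].

Let prefix_revS n s : prefix_rev n.+1 s = s (v n) :: prefix_rev n s.
Proof. by rewrite /prefix_rev -addn1 iotaD map_cat rev_cat. Qed.

Let size_prefix n s : size (prefix_rev n s) = n.
Proof. by rewrite /prefix_rev size_rev size_map size_iota. Qed.

Let q (w : seq S) : R := E [set s | prefix_rev (size w) s = w].

Let q0 w : 0 <= q w. Proof. exact: fa_ge0 faE _. Qed.

Let q1 : q [::] = 1.
Proof. by rewrite /q -(faT faE); congr E; apply/seteqP; split. Qed.

Let qS w : q w = \sum_s q (s :: w).
Proof.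
rewrite /q (fa_sum faE (fun s => s (v (size w)))); apply: eq_bigr => a _.
congr E; apply/seteqP; split => s /=; rewrite prefix_revS.
  by move=> [-> ->].
by case=> -> ->.
Qed.

Definition sample (u : measurableTypeR R) : config V S := fun x => letter q (iota_ x) u.

Lemma measurable_sample : measurable_fun [set: measurableTypeR R] sample.
Proof.
apply: (@measurability _ _ _ (config V S) _ _ (cylinders [set: V])) => // _ [_ [x _ [a _ <-]] <-].
rewrite setTI.
have -> : sample @^-1` [set s | s x = a] =
    [set u : R | 0 <= u < 1 /\ [set w | head point w = a] (word q (iota_ x).+1 u)] `|`
    ((~` [set` `[0, 1[]) `&` [set u | point = a]).
  apply/seteqP; split => u /=; rewrite in_itv /sample /letter /=.
    by case: ifP => h; [left|right].
  by case=> [[-> //]|[/negP/negbTE -> //]].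
apply: measurableU; first exact: measurable_word.
apply: measurableI; first by apply: measurableC.
case: (pselect (point = a)) => h.
  by rewrite (_ : [set _ | _] = setT) //; apply/seteqP; split.
by rewrite (_ : [set _ | _] = set0) //; apply/seteqP; split.
Qed.

HB.instance Definition _ := isMeasurableFun.Build _ _ _ _ sample measurable_sample.

Let unit01 : set (measurableTypeR R) := [set` `[0, 1[].
Let munit01 : measurable unit01. Proof. exact: measurable_itv. Qed.

Definition uniform01 : set (measurableTypeR R) -> \bar R :=
  mrestr lebesgue_measure munit01.

HB.instance Definition _ := Measure.on uniform01.

Let uniform01_setT : uniform01 setT = 1%:E.
Proof.
rewrite /uniform01 /mrestr setTI lebesgue_measure_itv /= lte_fin ltr01.
by rewrite -EFinB subr0.
Qed.

HB.instance Definition _ := @Measure_isProbability.Build _ _ R uniform01 uniform01_setT.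

(** Under the uniform law the address of u has the prescribed finite-dimensional
    laws, since the cell of a word is as long as its cylinder is probable. *)
Lemma extension : exists mu : probability (config V S) R,
  forall W (A : set (V -> S)), local_on W A -> mu A = (E A)%:E.
Proof.
exists (distribution uniform01 sample) => W A lA.
have [N NW] : exists N, forall x, x \in W -> (iota_ x < N)%N.
  exists (\max_(x <- W) iota_ x).+1 => x xW; rewrite ltnS.
  exact: leq_bigmax_seq.
(* the configuration spelled by a long enough word, as far as W is concerned *)
pose dec (w : seq S) : V -> S := fun x => nth point (rev w) (iota_ x).
transitivity (lebesgue_measure
    [set u : R | 0 <= u < 1 /\ [set w | A (dec w)] (word q N u)]).
  rewrite /= /distribution /pushforward /uniform01 /mrestr; congr lebesgue_measure.
  apply/seteqP; split => u /=; rewrite /unit01 /= in_itv /=.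
    move=> [Au u01]; split => //; apply: lA Au => x xW.
    by rewrite /dec nth_word ?NW.
  move=> [u01 Au]; split => //; apply: lA Au => x xW.
  by rewrite /dec nth_word ?NW.
rewrite (lebesgue_word q0 q1 qS); congr EFin.
pose f (s : V -> S) : N.-tuple S := @Tuple _ _ (prefix_rev N s) (introT eqP (size_prefix N s)).
rewrite (fa_sum faE f A) big_mkcond; apply: eq_bigr => t _.
have decE s : f s = t -> A s <-> A (dec t).
  move=> <-; have agree x : x \in W -> s x = dec (f s) x.
    move=> xW; rewrite /dec /= /prefix_rev revK (nth_map 0%N) ?size_iota ?NW //.
    by rewrite nth_iota ?NW // add0n iotaK.
  by split; apply: lA => x /agree ->.
case: asboolP => [At|nAt].
  congr E; apply/seteqP; split => s /=; rewrite size_tuple.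
    by move=> st; have fs : f s = t by [apply: val_inj]; split => //; apply/decE.
  by move=> [_ <-].
rewrite -(fa0 faE); congr E; apply/esym; rewrite -subset0 => s [As fs].
by apply: nAt; apply/(decE _ fs).
Qed.

End Extension.

(** * Limits along an ultrafilter, and local events *)

Section UltraLimit.
Variable R : realType.

(** The limit is the supremum of the numbers that f reaches along U. *)
Lemma ultra_limit (U : set_system nat) (f : nat -> R) : UltraFilter U ->
  (forall n, 0 <= f n <= 1) -> exists l : R, f @ U --> l.
Proof.
move=> UU f01; have UP : ProperFilter U := ultra_proper.
pose S : set R := [set c | U [set n | c <= f n]].
have S0 : S 0 by apply: filterS filterT => n _; case/andP: (f01 n).
have S1 : ubound S 1.
  move=> c /filter_ex[n /= cn]; apply: le_trans cn _; by case/andP: (f01 n).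
have hS : has_sup S by split; [exists 0 | exists 1].
exists (sup S); apply/cvgrPdist_lt => eps e0.
(* f reaches c > sup S - eps along U, and stays below sup S + eps along U since U
   decides every set *)
have [c Sc cl] := sup_adherent e0 hS.
have [h|h] := in_ultra_setVsetC [set n | sup S + eps <= f n] UU.
  have := sup_upper_bound hS h; lra.
rewrite /prop_near1/=; apply: filterS2 Sc h => n /= cn /negP; rewrite -ltNge => h.
by rewrite ltr_norml; apply/andP; split; lra.
Qed.

(** Along an ultrafilter the probabilities of all events converge at once, which
    does the work of a diagonal extraction. Linear relations between finitely many
    probabilities pass to the limit. *)
Lemma fa_limit (Om : Type) (P : nat -> set Om -> R) :
  (forall n, fin_additive (P n)) -> exists E : set Om -> R,
  [/\ fin_additive E,
      forall A c, (forall n, P n A <= c) -> E A <= c &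
      forall (T : finType) (a : T -> R) (B : T -> set Om) A n0,
        (forall n, (n0 <= n)%N -> P n A = \sum_t a t * P n (B t)) ->
        E A = \sum_t a t * E (B t)].
Proof.
move=> faP; have [U [UU ooU]] := @ultraFilterLemma nat \oo _.
have UP : ProperFilter U := ultra_proper.
have P1 n A : P n A <= 1.
  rewrite -(faT (faP n)) -(setUv A) (faU (faP n)) ?setICr//.
  by rewrite lerDl (fa_ge0 (faP n)).
have /choice[E EP] : forall A, exists l : R, P ^~ A @ U --> l.
  by move=> A; apply: ultra_limit => // n; rewrite P1 (fa_ge0 (faP n)).
have uniq_lim (f : nat -> R) (a b : R) : f @ U --> a -> f @ U --> b -> a = b.
  by move=> fa fb; apply: (cvg_unique (@Rhausdorff R) fa fb).
exists E; split.
- split.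
  + apply: (uniq_lim _ _ _ (EP setT)); apply: cvg_near_cst; rewrite /prop_near1.
    by apply: nearW => n; exact: faT (faP n).
  + by move=> A; apply: (cvgr_to_ge (EP A)); apply: nearW => n; exact: fa_ge0 (faP n) _.
  + move=> A B AB; apply: (uniq_lim _ _ _ (EP _)).
    apply: cvg_trans; last exact: cvgD (EP A) (EP B).
    apply: near_eq_cvg.
    by apply: nearW => n /=; rewrite (faU (faP n)).
- by move=> A c h; apply: (cvgr_to_le (EP A)); apply: nearW.
- move=> T a B A n0 h; apply: (uniq_lim _ _ _ (EP A)).
  have H : (fun n => \sum_t a t * P n (B t)) @ U --> \sum_t a t * E (B t).
    by apply: cvg_big => [|t _]; [exact: add_continuous | apply: cvgMl_tmp; exact: EP].
  apply: cvg_trans; last exact: H.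
  apply: near_eq_cvg; rewrite /prop_near1/=.
  apply: (filterS _ (ooU _ (nbhs_infty_ge n0))) => n /= nn.
  by rewrite h.
Qed.

End UltraLimit.

Section LocalSets.
Variables (V : choiceType) (S : finPointedType).

Lemma splice_in (L : {fset V}) (xi : {ffun L -> S}) eta (u : L) :
  splice xi eta (val u) = xi u.
Proof. by rewrite /splice insubT ?fsvalP // => h; congr (xi _); exact: val_inj. Qed.

Lemma splice_out (L : {fset V}) (xi : {ffun L -> S}) eta x : x \notin L ->
  splice xi eta x = eta x.
Proof. by move=> xL; rewrite /splice insubN. Qed.

Lemma splice_agree (L : {fset V}) (xi : {ffun L -> S}) eta eta' x :
  (x \notin L -> eta x = eta' x) -> splice xi eta x = splice xi eta' x.
Proof.
case: (boolP (x \in L)) => [xL _|xL /(_ isT) h]; last by rewrite !splice_out.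
by rewrite -[x]/(val [` xL]%fset) !splice_in.
Qed.

Lemma splice_self (L : {fset V}) (s eta : V -> S) x : x \in L ->
  splice [ffun u : L => s (val u)] eta x = s x.
Proof. by move=> xL; rewrite -[x]/(val [` xL]%fset) splice_in ffunE. Qed.

Lemma splice_id (L : {fset V}) (s : V -> S) :
  splice [ffun u : L => s (val u)] s = s.
Proof.
apply/funext => x; case: (boolP (x \in L)) => xL; first by rewrite splice_self.
by rewrite splice_out.
Qed.

Lemma measurable_local (D : set V) (W : {fset V}) (A : set (V -> S)) :
  [set` W] `<=` D -> local_on W A -> <<s @cylinders V S D >> A.
Proof.
move=> WD lA.
have -> : A = \bigcup_(t in [set t : {ffun W -> S} | A (splice t (fun=> point))])
   \bigcap_(u in [set: W]) [set s : V -> S | s (val u) = t u].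
  apply/seteqP; split => [s As|s [t /= At st]].
    exists [ffun u : W => s (val u)] => [|u _] /=; last by rewrite ffunE.
    by apply: lA As => x xW; rewrite splice_self.
  apply: lA At => x xW; rewrite -[x]/(val [` xW]%fset) splice_in.
  by rewrite (st [` xW]%fset I).
apply: (@fin_bigcup_measurable _ (g_sigma_algebraType (@cylinders V S D))) => // t _.
apply: (@fin_bigcap_measurable _ (g_sigma_algebraType (@cylinders V S D))) => // u _.
apply: sub_sigma_algebra; exists (val u); first by apply: WD => /=; exact: fsvalP.
by exists (t u).
Qed.

End LocalSets.

(** * Finite-volume Gibbs measures *)

Section Specification.
Variables (R : realType) (V : choiceType) (S : finPointedType).
Variable w : {fset V} -> (V -> S) -> R.

(** [spec_factor] is the consistency of the weights: in a larger volume the spins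
    in L enter only through w L. *)
Record specification : Prop := Specification {
  spec_ge0 : forall L s, 0 <= w L s;
  spec_local : forall L, exists N : {fset V}, forall s s' : V -> S,
    (forall x, x \in N -> s x = s' x) -> w L s = w L s';
  spec_factor : forall L M : {fset V}, {subset L <= M} ->
    exists r : (V -> S) -> R, (forall s, w M s = w L s * r s) /\
    forall s s' : V -> S, (forall x, x \notin L -> s x = s' x) -> r s = r s' }.

Hypothesis spec : specification.

Definition partition_fun (L : {fset V}) (eta : V -> S) : R :=
  \sum_(xi : {ffun L -> S}) w L (splice xi eta).

(** When all weights vanish no law is proportional to them, and the uniform one
    keeps the dependence on eta measurable. *)
Definition cond_law (L : {fset V}) (eta : V -> S) (xi : {ffun L -> S}) : R :=
  if partition_fun L eta == 0 then #|{ffun L -> S}|%:R^-1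
  else w L (splice xi eta) / partition_fun L eta.

Arguments cond_law L eta xi : clear implicits.

Lemma partition_ge0 L eta : 0 <= partition_fun L eta.
Proof. by apply: sumr_ge0 => xi _; exact: spec_ge0. Qed.

Lemma cond_law_ge0 L eta xi : 0 <= cond_law L eta xi.
Proof.
rewrite /cond_law; case: ifP => _; first by rewrite invr_ge0.
by rewrite divr_ge0 ?partition_ge0 ?spec_ge0.
Qed.

Lemma cond_law_sum L eta : \sum_xi cond_law L eta xi = 1.
Proof.
rewrite /cond_law; case: (eqVneq (partition_fun L eta) 0) => [_|Z0]; last first.
  by rewrite -mulr_suml divff.
rewrite sumr_const -[LHS]mulr_natl mulfV // pnatr_eq0 -lt0n.
by apply/card_gt0P; exists [ffun=> point].
Qed.

Lemma cond_lawM L eta xi : cond_law L eta xi * partition_fun L eta = w L (splice xi eta).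
Proof.
rewrite /cond_law; case: eqP => [Z0|/eqP Z0]; last by rewrite divfK.
rewrite Z0 mulr0; apply/esym/eqP; move/eqP: Z0.
rewrite /partition_fun psumr_eq0 => [/allP/(_ xi)|*]; last exact: spec_ge0.
by rewrite mem_index_enum => /(_ isT).
Qed.

Lemma partition_local (L : {fset V}) : exists2 N : {fset V},
  {in N, forall x, x \notin L} & forall s s' : V -> S,
  (forall x, x \in N -> s x = s' x) ->
  forall xi : {ffun L -> S}, w L (splice xi s) = w L (splice xi s').
Proof.
have [N HN] := spec_local spec L; exists (N `\` L)%fset.
  by move=> x; rewrite in_fsetD => /andP[].
move=> s s' ss' xi; apply: HN => x xN; apply: splice_agree => xL.
by apply: ss'; rewrite in_fsetD xL.
Qed.

(** Exchanging xi with the spins of t in L is an involution of the pairs (t, xi). *)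
Lemma resample (L M : {fset V}) (eta : V -> S) (F : (V -> S) -> R) :
  {subset L <= M} ->
  \sum_(t : {ffun M -> S}) \sum_(xi : {ffun L -> S}) F (splice xi (splice t eta)) =
  #|{ffun L -> S}|%:R * \sum_(t : {ffun M -> S}) F (splice t eta).
Proof.
move=> LM; rewrite pair_bigA /=.
(* the two components of swap a are a.1 overwritten by a.2, and the spins lost *)
pose swap (a : {ffun M -> S} * {ffun L -> S}) : {ffun M -> S} * {ffun L -> S} :=
  ([ffun u : M => splice a.2 (splice a.1 eta) (val u)],
   [ffun u : L => splice a.1 eta (val u)]).
have swap1 a : splice (swap a).1 eta = splice a.2 (splice a.1 eta).
  apply/funext => x; case: (boolP (x \in M)) => xM; first by rewrite splice_self.
  have xL : x \notin L by apply: contra xM => /LM.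
  by rewrite !splice_out.
have swapK : involutive swap.
  move=> [t xi]; congr pair; apply/ffunP => u; rewrite ffunE.
    rewrite swap1 /=; case: (boolP (val u \in L)) => uL.
      by rewrite splice_self // splice_in.
    by rewrite splice_out // splice_out // splice_in.
  by rewrite swap1 /= splice_in.
rewrite (reindex_inj (inv_inj swapK)).
transitivity (\sum_(a : {ffun M -> S} * {ffun L -> S}) F (splice a.1 eta)).
  by apply: eq_bigr => a _; rewrite -(swap1 (swap a)) swapK.
rewrite -(pair_bigA _ (fun t _ => F (splice t eta))) /= mulr_sumr.
by apply: eq_bigr => t _; rewrite sumr_const -[LHS]mulr_natl.
Qed.

Variables (iota_ : V -> nat) (v : nat -> V).
Hypothesis iotaK : cancel iota_ v.
Variables (eta0 : V -> S) (Lam : nat -> {fset V}).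
Hypothesis eta0_gt0 : forall L, 0 < w L eta0.
Hypothesis Lam_exhaust : forall L : {fset V}, exists n0, forall n, (n0 <= n)%N ->
  {subset L <= Lam n}.

Let Z n := partition_fun (Lam n) eta0.

Let Z0 n : 0 < Z n.
Proof.
rewrite /Z /partition_fun (bigD1 [ffun u : Lam n => eta0 (val u)]) //= splice_id.
by apply: ltr_pwDl => //; apply: sumr_ge0 => *; exact: spec_ge0.
Qed.

Definition finite_volume n (A : set (V -> S)) : R :=
  (\sum_(t : {ffun Lam n -> S} | `[< A (splice t eta0) >])
     w (Lam n) (splice t eta0)) / Z n.

Lemma finite_volume_fa n : fin_additive (finite_volume n).
Proof.
split.
- rewrite /finite_volume (_ : \sum_(t | _) _ = Z n) ?divff ?gt_eqF //.
  by apply: eq_bigl => t; apply/asboolP.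
- move=> A; apply: divr_ge0; last exact/ltW/Z0.
  by apply: sumr_ge0 => *; exact: spec_ge0.
- move=> A B AB; rewrite /finite_volume -mulrDl; congr (_ / _).
  rewrite (bigID (fun t => `[< A (splice t eta0) >])) /=; congr (_ + _); apply: eq_bigl => t.
    apply/andP/asboolP => [[_ /asboolP//]|At]; split; apply/asboolP => //; by left.
  apply/andP/asboolP => [[/asboolP[At|//] /asboolP //]|Bt]; split; apply/asboolP; first by right.
  by move=> At; have : (A `&` B) (splice t eta0) by []; rewrite AB.
Qed.

Definition cyl (L : {fset V}) (xi : {ffun L -> S}) : set (V -> S) :=
  [set s | forall u : L, s (val u) = xi u].

Lemma cyl_splice (L : {fset V}) (xi ze : {ffun L -> S}) s :
  cyl xi (splice ze s) <-> ze = xi.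
Proof.
split => [h|-> u]; last by rewrite splice_in.
by apply/ffunP => u; rewrite -h splice_in.
Qed.

(** Resampling the spins in L affects neither B nor the conditional law, and
    averages the weight over L. *)
Lemma finite_volume_dlr n (L N : {fset V}) (xi : {ffun L -> S}) (W : {fset V})
    (B : set (V -> S)) : {subset L <= Lam n} ->
  {in N, forall x, x \notin L} -> {in W, forall x, x \notin L} ->
  local_on W B ->
  (forall s s' : V -> S, (forall x, x \in N -> s x = s' x) ->
     cond_law L s xi = cond_law L s' xi) ->
  finite_volume n (B `&` cyl xi) = \sum_(t : {ffun N -> S})
    cond_law L (splice t (fun=> point)) xi * finite_volume n (B `&` cyl t).
Proof.
move=> LM NL WL lB lp.
have B_splice (ze : {ffun L -> S}) s : B (splice ze s) <-> B s.
  by split; apply: lB => x /WL xL; rewrite splice_out.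
have p_splice (ze : {ffun L -> S}) s : cond_law L (splice ze s) xi = cond_law L s xi.
  by apply: lp => x /NL xL; rewrite splice_out.
have [r [wr rL]] := spec_factor spec LM.
have r_splice (ze : {ffun L -> S}) s : r (splice ze s) = r s.
  by apply: rL => x xL; rewrite splice_out.
pose F1 s := if `[< (B `&` cyl xi) s >] then w (Lam n) s else 0.
pose F2 s := if `[< B s >] then cond_law L s xi * w (Lam n) s else 0.
have F12 : \sum_(t : {ffun Lam n -> S}) F1 (splice t eta0) =
           \sum_(t : {ffun Lam n -> S}) F2 (splice t eta0).
  have cL : (#|{ffun L -> S}|%:R : R) != 0.
    by rewrite pnatr_eq0 -lt0n; apply/card_gt0P; exists [ffun=> point].
  apply: (mulfI cL); rewrite -!(resample _ _ LM); apply: eq_bigr => t _.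
  set s := splice t eta0; rewrite /F1 /F2.
  case: (pselect (B s)) => Bs; last first.
    rewrite !big1 // => ze _; case: asboolP => //.
      by move=> /B_splice.
    by move=> [/B_splice].
  transitivity (w L (splice xi s) * r s).
    rewrite (bigD1 xi) //= big1 ?addr0.
      case: asboolP => [_|[]]; first by rewrite wr r_splice.
      by split; [apply/B_splice | apply/cyl_splice].
    by move=> ze zx; case: asboolP => // -[_ /cyl_splice zx']; rewrite zx' eqxx in zx.
  under [RHS]eq_bigr => ze _.
    case: asboolP => [_|[]]; last by apply/B_splice.
    rewrite p_splice wr r_splice mulrA; over.
  by rewrite -mulr_suml -mulr_sumr cond_lawM.
rewrite /finite_volume; under [RHS]eq_bigr do rewrite mulrA.
rewrite -mulr_suml; congr (_ / _).
rewrite big_mkcond /= F12.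
under [RHS]eq_bigr do rewrite mulr_sumr big_mkcond.
rewrite exchange_big /=; apply: eq_bigr => t _; rewrite /F2.
set s := splice t eta0; pose tN := [ffun u : N => s (val u)].
case: asboolP => [Bs|nBs]; last first.
  by rewrite big1 // => ze _; case: asboolP => // -[].
rewrite (bigD1 tN) //= big1 ?addr0.
  case: asboolP => [_|[]]; last by split=> // u; rewrite ffunE.
  by congr (_ * _); apply: lp => x xN; rewrite splice_self.
move=> ze zt; case: asboolP => // -[_ cz]; move: zt; rewrite (_ : ze = tN) ?eqxx //.
by apply/ffunP => u; rewrite ffunE cz.
Qed.

End Specification.

Arguments cond_law {R V S} w L eta xi.

(** * Infinite-volume Gibbs measures *)

Section GibbsLimit.
Variables (R : realType) (V : choiceType) (S : finPointedType).
Lemma measurable_off_on (L : {fset V}) (B : set (V -> S)) :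
  <<s @cylinders V S (~` [set` L]) >> B -> <<s @cylinders V S [set: V] >> B.
Proof.
apply: sub_sigma_algebra2 => _ [x _ [a _ <-]]; exists x => //; by exists a.
Qed.

Lemma cyl_local (L : {fset V}) (xi : {ffun L -> S}) : local_on L (cyl xi).
Proof. by move=> s s' ss' h u; rewrite -ss' ?h //; exact: fsvalP. Qed.

Lemma local_onI (W W' : {fset V}) (A B : set (V -> S)) :
  local_on W A -> local_on W' B -> local_on (W `|` W')%fset (A `&` B).
Proof.
move=> lA lB s s' ss' [As Bs]; split.
  by apply: lA As => x xW; apply: ss'; rewrite in_fsetU xW.
by apply: lB Bs => x xW; apply: ss'; rewrite in_fsetU xW orbT.
Qed.

Variable mu : probability (config V S) R.

(** p is constant on each cylinder over N. *)
Lemma integral_local (N : {fset V}) (B : set (config V S)) (p : (V -> S) -> R) :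
  measurable B -> (forall s, 0 <= p s) ->
  (forall s s' : V -> S, (forall x, x \in N -> s x = s' x) -> p s = p s') ->
  (\int[mu]_(s in B) (p s)%:E)%E =
  (\sum_(t : {ffun N -> S}) (p (splice t (fun=> point)))%:E * mu (B `&` cyl t))%E.
Proof.
move=> mB p0 lp.
have mcyl (t : {ffun N -> S}) : measurable (cyl t : set (config V S)).
  by apply: (@measurable_local _ _ _ N) => //; exact: cyl_local.
have mp : measurable_fun [set: config V S] ((fun s => (p s)%:E) : config V S -> \bar R).
  apply/measurable_EFinP => _ Y mY; rewrite setTI.
  apply: (@measurable_local _ _ _ N) => // s s' ss'; by rewrite /= (lp _ _ ss').
have BE : B = \big[setU/set0]_(t : {ffun N -> S}) (B `&` cyl t).
  rewrite -bigcup_seq; apply/seteqP; split => [s Bs|s [t _ []//]].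
  exists [ffun u : N => s (val u)]; first by rewrite /= mem_index_enum.
  by split => // u; rewrite ffunE.
rewrite [in LHS]BE ge0_integral_bigsetU //=; last first.
- by move=> s _; rewrite lee_fin.
- exact: measurable_funS mp.
- apply/trivIsetP => t t' _ _ /eqP tt'; rewrite -subset0 => s [[_ st] [_ st']].
  by apply: tt'; apply/ffunP => u; rewrite -st -st'.
- exact: index_enum_uniq.
- by move=> t; exact: measurableI.
apply: eq_bigr => t _.
rewrite (eq_integral (cst (p (splice t (fun=> point)))%:E)); last first.
  move=> s; rewrite inE => -[_ st] /=; congr EFin; apply: lp => x xN.
  by rewrite -[x]/(val [` xN]%fset) splice_in st.
by rewrite integral_cst //; exact: measurableI.
Qed.

End GibbsLimit.

Section GibbsExists.
Variables (R : realType) (V : choiceType) (S : finPointedType).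
Variable w : {fset V} -> (V -> S) -> R.
Hypothesis spec : specification w.
Variables (iota_ : V -> nat) (v : nat -> V).
Hypothesis iotaK : cancel iota_ v.
Variables (eta0 : V -> S) (Lam : nat -> {fset V}).
Hypothesis eta0_gt0 : forall L, 0 < w L eta0.
Hypothesis Lam_exhaust : forall L : {fset V}, exists n0, forall n, (n0 <= n)%N ->
  {subset L <= Lam n}.

(** The finite-volume conditional identities are linear relations between finitely
    many probabilities of local events, hence pass to the limit. They extend to
    the sigma-algebra off L by Dynkin's lemma. In finite volume the weights in L
    almost surely do not all vanish, and this is a local event. *)
Lemma gibbs_limit : exists mu : probability (config V S) R, is_gibbs w mu /\
  forall (W : {fset V}) (A : set (V -> S)) c, local_on W A ->
    (forall n, finite_volume w eta0 Lam n A <= c) -> (mu A <= c%:E)%E.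
Proof.
have [E [faE Ele Elin]] := fa_limit (finite_volume_fa spec Lam eta0_gt0).
have [mu muE] := extension iotaK faE.
exists mu; split; last by move=> W A c lA h; rewrite (muE _ _ lA) lee_fin Ele.
move=> L; have [N NL wN] := partition_local spec L.
have lp (s s' : V -> S) : (forall x, x \in N -> s x = s' x) ->
    forall xi : {ffun L -> S}, cond_law w L s xi = cond_law w L s' xi.
  move=> ss' xi; have h := wN _ _ ss'; rewrite /cond_law /partition_fun h.
  by under eq_bigr do rewrite h.
have NoffL : [set` N] `<=` ~` [set` L] by move=> x /NL /negP.
exists (cond_law w L); first split.
- exact: cond_law_ge0.
- exact: cond_law_sum.
- move=> xi _ Y mY; rewrite setTI; apply: (measurable_local NoffL) => s s' ss' /=.
  by rewrite (lp _ _ ss').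
- move=> xi B mB.
  have mon (F : set (config_off S L)) : measurable F -> measurable (F : set (config V S)).
    exact: measurable_off_on.
  have mcyl : measurable (cyl xi : set (config V S)).
    by apply: (@measurable_local _ _ _ L) => //; exact: cyl_local.
  have mp : measurable_fun [set: config V S]
      ((fun s => (cond_law w L s xi)%:E) : config V S -> \bar R).
    apply/measurable_EFinP => _ Y mY; rewrite setTI.
    apply: (@measurable_local _ _ _ N) => // s s' ss'; by rewrite /= (lp _ _ ss').
  pose G : set (set (V -> S)) := [set F | exists W : {fset V},
    {in W, forall x, x \notin L} /\ local_on W F].
  have GP F : G F -> mu (F `&` cyl xi) = (\int[mu]_(s in F) (cond_law w L s xi)%:E)%E.
    move=> [W [WL lF]].
    have WoffL : [set` W] `<=` ~` [set` L] by move=> x /WL /negP.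
    have mF : measurable (F : set (config V S)).
      exact: mon (measurable_local WoffL lF).
    rewrite (@integral_local _ _ _ _ N) //; first last.
    + by move=> s s' ss'; exact: lp.
    + by move=> s; exact: cond_law_ge0.
    rewrite (muE _ _ (local_onI lF (@cyl_local _ _ _ xi))).
    have [n0 hn0] := Lam_exhaust L.
    rewrite (Elin _ (fun t : {ffun N -> S} => cond_law w L (splice t (fun=> point)) xi)
      (fun t => F `&` cyl t) _ n0).
      rewrite -sumEFin; apply: eq_bigr => t _.
      by rewrite EFinM (muE _ _ (local_onI lF (@cyl_local _ _ _ t))).
    move=> n /hn0 Ln; apply: (finite_volume_dlr spec _ Ln NL WL lF).
    by move=> s s' ss'; exact: lp.
  have GT : G setT by exists fset0; split => // x; rewrite in_fset0.
  have GE : @measurable _ (config_off S L) = <<s G >>.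
    apply/seteqP; split.
      apply: sub_sigma_algebra2 => _ [x xL [a _ <-]]; exists [fset x]%fset; split.
        by move=> y /fset1P ->; apply/negP.
      by move=> s s' ss' <-; rewrite /= ss' // in_fset1.
    apply: smallest_sub; first exact: sigma_algebra_measurable.
    move=> F [W [WL lF]]; apply: (measurable_local (W := W)) => // x /WL /negP //.
  have p0 s : (0 <= (cond_law w L s xi)%:E)%E by rewrite lee_fin cond_law_ge0.
  move: mB; rewrite -[X in X -> _]/(<<s @cylinders V S (~` [set` L]) >> B) => mB.
  apply: (@dynkin_induction _ (config_off S L) G
    (fun F => mu (F `&` cyl xi) = (\int[mu]_(s in F) (cond_law w L s xi)%:E)%E)).
  + exact: GE.
  + move=> F F' [W [WL lF]] [W' [WL' lF']]; exists (W `|` W')%fset; split.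
      by move=> x; rewrite in_fsetU => /orP[/WL|/WL'].
    exact: local_onI.
  + exact: GP.
  + by move=> F; exact: GP.
  + move=> F /mon mF PF.
    have := GP _ GT; rewrite -(setUv F) setIUl measureU //; first last.
    * by rewrite setIACA setICr set0I.
    * by apply: measurableI => //; exact: measurableC.
    * exact: measurableI.
    rewrite ge0_integral_setU //; first last.
    * by apply/disj_setPS; rewrite setICr.
    * exact: measurable_funS mp.
    * exact: measurableC.
    have ffin : mu (F `&` cyl xi) \is a fin_num.
      by rewrite fin_num_measure //; exact: measurableI.
    rewrite -PF => /(congr1 (fun z => z - mu (F `&` cyl xi))%E).
    by rewrite ![(mu (F `&` cyl xi) + _)%E]addeC !addeK.
  + move=> F mF tF PF.
    have mF' n : measurable (F n : set (config V S)) := mon _ (mF n).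
    rewrite setI_bigcupl measure_bigcup //; first last.
    * by apply/trivIsetP => i j _ _ ij; move/trivIsetP: tF => /(_ i j I I ij);
        rewrite setIACA => ->; rewrite set0I.
    * by move=> n _; exact: measurableI.
    rewrite ge0_integral_bigcup //; last exact: measurable_funS mp.
    rewrite (@eq_eseriesl _ _ xpredT); last by move=> n; rewrite in_setT.
    by apply: eq_eseriesr => n _; exact: PF.
  + by rewrite -GE.
- exists [set s | partition_fun w L s = 0]; split.
  + apply: (@measurable_local _ _ _ N) => // s s' ss' /=.
    by rewrite /partition_fun; under eq_bigr do rewrite (wN _ _ ss').
  + rewrite (muE N); last first.
      move=> s s' ss' /=.
      by rewrite /partition_fun; under eq_bigr do rewrite (wN _ _ ss').
    have [n0 hn0] := Lam_exhaust L.
    rewrite (Elin void (fun=> 0) (fun=> set0) _ n0); first by rewrite big1 // => -[].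
    move=> n /hn0 Ln; rewrite [RHS]big1; last by case.
    rewrite /finite_volume big1 ?mul0r // => t /asboolP /= Z0.
    have [r [wr _]] := spec_factor spec Ln; rewrite wr.
    move/eqP: Z0; rewrite /partition_fun psumr_eq0 => [/allP h|*]; last exact: spec_ge0.
    have := h [ffun u : L => splice t eta0 (val u)] (mem_index_enum _).
    by rewrite splice_id => /eqP ->; rewrite mul0r.
  + move=> s /= nP; apply: contrapT => Z0; apply: nP.
    exists (partition_fun w L s)^-1 => xi.
    by rewrite /cond_law; case: eqP => // _; rewrite mulrC.
Qed.

End GibbsExists.

(** * Two phases from two boundary conditions *)

Section TwoPhases.
Context {R : realType} {V : choiceType} {e : rel V} {G : infinite_graph e}.
Variable S : finPointedType.
Variable w : {fset V} -> (V -> S) -> R.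
Hypothesis spec : specification w.

(** The vertices are exhausted by the finite balls around o. *)
Lemma graph_countable (o : V) : exists (i : V -> nat) (v : nat -> V), cancel i v.
Proof.
have cV : countable [set: V].
  apply: (@sub_countable _ _ _ (\bigcup_(n in [set: nat]) nball e o n)).
    by apply: subset_card_le => x _; exists (gdist e o x) => //=; rewrite /nball /=.
  by apply: bigcup_countable => // n _; apply: finite_set_countable; exact: nball_finite.
have /countable_injP[i inji] := cV.
exists i, (fun n => xget o [set x | i x = n]) => x /=.
case: xgetP => [y _ /= xy|/(_ x)[]//]; apply: inji; rewrite ?in_setT //.
Qed.

Definition boundary_sum (L : {fset V}) (eta : V -> S) (A : set (V -> S)) : R :=
  \sum_(t : {ffun L -> S} | `[< A (splice t eta) >]) w L (splice t eta).

(** The limit for eta1 gives A probability at least 5/8, that for eta2 at most 3/8. *)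
Lemma two_phases (o : V) (eta1 eta2 : V -> S) (A : set (V -> S)) :
  (forall s s' : V -> S, s o = s' o -> A s -> A s') ->
  (forall L, 0 < w L eta1) -> (forall L, 0 < w L eta2) ->
  (forall L, boundary_sum L eta1 (~` A) <= 3 / 8 * boundary_sum L eta1 setT) ->
  (forall L, boundary_sum L eta2 A <= 3 / 8 * boundary_sum L eta2 setT) ->
  multiple_gibbs w.
Proof.
move=> Ao w1 w2 h1 h2; have [i [v iK]] := graph_countable o.
pose Lam n := fset_set (nball e o n).
have Lam_ex (L : {fset V}) : exists n0, forall n, (n0 <= n)%N -> {subset L <= Lam n}.
  exists (\max_(x <- L) gdist e o x) => n Ln x xL.
  rewrite in_fset_set ?inE; last exact: nball_finite.
  by apply: leq_trans Ln; exact: leq_bigmax_seq.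
have lA : local_on [fset o]%fset A.
  by move=> s s' ss'; apply: Ao; apply: ss'; rewrite in_fset1.
have lA' : local_on [fset o]%fset (~` A).
  by move=> s s' ss' nA A'; apply: nA; apply: Ao A'; rewrite ss' // in_fset1.
have bsT L eta : boundary_sum L eta setT = partition_fun w L eta.
  by apply: eq_bigl => t; apply/asboolP.
have fvle eta B : (forall L, 0 < w L eta) ->
    (forall L, boundary_sum L eta B <= 3 / 8 * boundary_sum L eta setT) ->
    forall n, finite_volume w eta Lam n B <= 3 / 8.
  move=> w0 h n; rewrite /finite_volume ler_pdivrMr -?bsT; first exact: h.
  rewrite bsT /partition_fun (bigD1 [ffun u : Lam n => eta (val u)]) //= splice_id.
  by apply: ltr_pwDl => //; apply: sumr_ge0 => *; exact: spec_ge0.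
have [mu [gmu muP]] := gibbs_limit spec iK w1 Lam_ex.
have [nu [gnu nuP]] := gibbs_limit spec iK w2 Lam_ex.
have mA : measurable (A : set (config V S)).
  by apply: (@measurable_local _ _ _ [fset o]%fset).
exists mu, nu; split => //; exists A => // eqA.
have := muP _ _ _ lA' (fvle _ _ w1 h1); have := nuP _ _ _ lA (fvle _ _ w2 h2).
rewrite -eqA probability_setC // => hA.
have /fineK <- : mu A \is a fin_num by rewrite fin_num_measure.
rewrite -EFinB !lee_fin => hb; move: hA.
have /fineK <- : mu A \is a fin_num by rewrite fin_num_measure.
by rewrite lee_fin => ha; clear eqA; lra.
Qed.

End TwoPhases.

(** * Models in which links force equal signs *)

Lemma ler_sum_sub (R : realFieldType) (I : finType) (P Q : pred I) (F : I -> R) :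
  (forall i, 0 <= F i) -> (forall i, P i -> F i != 0 -> Q i) ->
  \sum_(i | P i) F i <= \sum_(i | Q i) F i.
Proof.
move=> F0 PQ; rewrite big_mkcond [leRHS]big_mkcond; apply: ler_sum => i _.
case: ifPn => [Pi|_]; last by case: ifP.
by case: ifPn => // nQ; case: (eqVneq (F i) 0) => [->//|/(PQ _ Pi)]; rewrite (negbTE nQ).
Qed.

(** The map f gains a factor 1 / c, and k tells apart the points of its fibres. *)
Lemma injection_bound (R : realFieldType) (T K : finType) (W : T -> R) (c : R)
    (f : T -> T) (k : T -> K) (P P' : pred T) :
  (forall t, 0 <= W t) -> 0 <= c ->
  (forall t, P t -> W t != 0 -> W t <= c * W (f t) /\ P' (f t)) ->
  (forall t t', P t -> P t' -> W t != 0 -> W t' != 0 -> f t = f t' ->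
     k t = k t' -> t = t') ->
  \sum_(t | P t) W t <= c * #|K|%:R * \sum_(t | P' t) W t.
Proof.
move=> W0 c0 h inj; pose A := [set t | P t && (W t != 0)]%SET.
have -> : \sum_(t | P t) W t = \sum_(t in A) W t.
  rewrite [LHS](bigID (fun t => W t == 0)) /= big1 ?add0r => [|t /andP[_ /eqP//]].
  by apply: eq_bigl => t; rewrite inE.
pose hh t := (f t, k t).
have injA : {in A &, injective hh}.
  by move=> t t'; rewrite !inE => /andP[? ?] /andP[? ?] [] *; exact: inj.
apply: (@le_trans _ _ (\sum_(t in A) c * W (hh t).1)).
  by apply: ler_sum => t; rewrite inE => /andP[Pt Wt]; have [] := h _ Pt Wt.
rewrite -(big_imset (fun p => c * W p.1) injA) /=.
apply: (@le_trans _ _ (\sum_(p : T * K | P' p.1 && xpredT p.2) c * W p.1)).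
  apply: ler_sum_sub => [p|p]; first by rewrite mulr_ge0.
  by move=> /imsetP[t]; rewrite inE => /andP[Pt Wt] -> _; have [_ ->] := h _ Pt Wt.
rewrite -(pair_big P' xpredT (fun t _ => c * W t)) /= -mulrA !mulr_sumr.
apply: ler_sum => t _; rewrite sumr_const -[leLHS]mulr_natl.
by rewrite mulrCA.
Qed.


(** Spins with a sign [sg], None for an empty site, some of which are strong. A
    link between two adjacent spins forces their signs to agree, and strong spins
    are always linked. [setb b] gives the sign b to a spin without altering its
    links; [top b] is the strong spin of sign b used as boundary condition. *)
Record spin_axioms (S : finPointedType) (sg : S -> option bool) (strong : pred S)
    (link : rel S) (setb : bool -> S -> S) (top : bool -> S) : Prop := SpinAxioms {
  link_sym : symmetric link;
  link_sg : forall s t, link s t -> sg s != None;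
  strong_link : forall s t, strong s -> strong t -> link s t;
  link_setb : forall b s t, link (setb b s) t = link s t;
  sg_setb : forall b s, sg (setb b s) = omap (fun=> b) (sg s);
  strong_setb : forall b s, strong (setb b s) = strong s;
  setb_inj : forall b s t, setb b s = setb b t -> sg s = sg t -> s = t;
  strong_top : forall b, strong (top b);
  sg_top : forall b, sg (top b) = Some b;
  setb_top : forall b, setb b (top b) = top b }.

Section SiteModel.
Context {R : realType} {V : choiceType} {e : rel V} {G : infinite_graph e}.
Hypothesis eirr : irreflexive e.
Variables (S : finPointedType) (sg : S -> option bool) (strong : pred S)
  (link : rel S) (setb : bool -> S -> S) (top : bool -> S).
Hypothesis ax : spin_axioms sg strong link setb top.
Variable lam : R.
Hypothesis lam0 : 0 < lam.

Definition admissible (L : {fset V}) (s : V -> S) := forall x y, e x y ->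
  x \in L \/ y \in L -> link (s x) (s y) -> sg (s x) = sg (s y).

Definition site_weight (L : {fset V}) (s : V -> S) : R :=
  if `[< admissible L s >] then lam ^+ #|` [fset x in L | strong (s x)]%fset| else 0.

Definition closed_nbhd (L : {fset V}) : {fset V} :=
  fset_set (\bigcup_(x in [set` L]) nball e x 1).

Lemma closed_nbhdP (L : {fset V}) x y : x \in L -> (gdist e x y <= 1)%N ->
  y \in closed_nbhd L.
Proof.
move=> xL xy; rewrite in_fset_set ?inE; first by exists x.
by apply: bigcup_finite => // *; exact: nball_finite.
Qed.

Lemma sub_closed_nbhd (L : {fset V}) : {subset L <= closed_nbhd L}.
Proof. by move=> x xL; apply: (closed_nbhdP xL); rewrite gdistxx. Qed.

Lemma site_spec : specification site_weight.
Proof.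
split.
- by move=> L s; rewrite /site_weight; case: asboolP => // _; rewrite exprn_ge0 // ltW.
- move=> L; exists (closed_nbhd L) => s s' ss'; rewrite /site_weight.
  have cnt : [fset x in L | strong (s x)]%fset = [fset x in L | strong (s' x)]%fset.
    apply/fsetP => x; rewrite !inE; case: (boolP (x \in L)) => //= xL.
    by rewrite ss' // sub_closed_nbhd.
  have ends x y : e x y -> x \in L \/ y \in L -> s x = s' x /\ s y = s' y.
    move=> xy [xL|yL]; split; apply: ss'.
    + exact: sub_closed_nbhd.
    + by apply: (closed_nbhdP xL); exact: gdist_edge.
    + by apply: (closed_nbhdP yL); apply: gdist_edge; exact: edge_sym.
    + exact: sub_closed_nbhd.
  have -> : admissible L s = admissible L s'.
    by apply/propext; split => h x y xy xyL; have := h x y xy xyL;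
      have [-> ->] := ends _ _ xy xyL.
  by rewrite cnt.
- move=> L M LM.
  pose rest s := forall x y, e x y -> x \in M \/ y \in M -> x \notin L -> y \notin L ->
    link (s x) (s y) -> sg (s x) = sg (s y).
  exists (fun s => if `[< rest s >] then
     lam ^+ #|` [fset x in (M `\` L)%fset | strong (s x)]%fset| else 0); split.
    move=> s; rewrite /site_weight.
    have -> : `[< admissible M s >] = `[< admissible L s >] && `[< rest s >].
      apply/asboolP/andP => [h|[/asboolP hL /asboolP hr] x y xy xyM].
        split; apply/asboolP => x y xy.
          by move=> [/LM xM|/LM yM]; apply: h => //; [left|right].
        by move=> xyM _ _; exact: h.
      case: (boolP (x \in L)) => xL; first by apply: hL => //; left.
      case: (boolP (y \in L)) => yL; first by apply: hL => //; right.
      exact: hr.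
    case: asboolP => _ /=; last by rewrite mul0r.
    case: asboolP => _ /=; last by rewrite mulr0.
    rewrite -exprD; congr (_ ^+ _).
    rewrite -(cardfsID L [fset x in M | strong (s x)]%fset); congr (_ + _)%N.
      congr (size (enum_fset _)); apply/fsetP => x; rewrite !inE.
      by case: (boolP (x \in L)) => [/LM ->|]; rewrite ?andbT ?andbF.
    congr (size (enum_fset _)); apply/fsetP => x; rewrite !inE.
    by rewrite andbA.
  move=> s s' ss'.
  have -> : [fset x in (M `\` L)%fset | strong (s x)]%fset =
            [fset x in (M `\` L)%fset | strong (s' x)]%fset.
    apply/fsetP => x; rewrite !inE; case: (boolP (x \in L)) => //= xL.
    by rewrite ss'.
  have -> // : rest s = rest s'.
  by apply/propext; split => h x y xy xyM xL yL; have := h x y xy xyM xL yL;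
    rewrite !ss'.
Qed.

Variable b : bool.
Let eta : V -> S := fun=> top b.

Lemma site_top_gt0 L : 0 < site_weight L eta.
Proof.
rewrite /site_weight; case: asboolP => [_|[]]; first exact: exprn_gt0.
by move=> x y _ _ _; rewrite !(sg_top ax).
Qed.

Definition linked (s : V -> S) : rel V := fun x y => e x y && link (s x) (s y).

Definition touched (v : V) (s : V -> S) (u : V) : Prop :=
  exists2 y, (y = v \/ e v y) & reach (linked s) [set: V] y u.

(** The clusters of linked spins that meet the closed neighbourhood of v take the
    sign b, after which v can become strong whatever its neighbours are. *)
Definition repaint (v : V) (s : V -> S) (u : V) : S :=
  if u == v then top b else if `[< touched v s u >] then setb b (s u) else s u.

Lemma linked_step v s x y : touched v s x -> e x y -> link (s x) (s y) -> touched v s y.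
Proof.
move=> [z zv zx] xy l; exists z => //; apply: (reachS zx) => //.
by rewrite /linked xy.
Qed.

Lemma link_repaint v s x y : x != v -> y != v ->
  link (repaint v s x) (repaint v s y) = link (s x) (s y).
Proof.
move=> xv yv; rewrite /repaint (negbTE xv) (negbTE yv).
have setbr c s1 t1 : link s1 (setb c t1) = link s1 t1.
  by rewrite (link_sym ax) (link_setb ax) (link_sym ax).
by case: asboolP => _; case: asboolP => _; rewrite ?(link_setb ax) ?setbr.
Qed.

Lemma strong_repaint v s x : x != v -> strong (repaint v s x) = strong (s x).
Proof.
by move=> xv; rewrite /repaint (negbTE xv); case: asboolP => // _; rewrite (strong_setb ax).
Qed.

Lemma touched_nbr v s y : e v y -> touched v s y.
Proof. by move=> vy; exists y; [right|exact: reach0]. Qed.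

Lemma repaint_admissible L v s : admissible L s -> admissible L (repaint v s).
Proof.
have ends y : e v y -> link (top b) (repaint v s y) ->
    sg (top b) = sg (repaint v s y).
  move=> vy; have yv : y != v by apply: contraTneq vy => ->; rewrite eirr.
  rewrite /repaint (negbTE yv); case: asboolP => [_|[]]; last exact: touched_nbr.
  rewrite (link_sym ax) => /(link_sg ax); rewrite (sg_setb ax) (sg_top ax).
  by case: (sg (s y)).
move=> adm x y xy xyL.
have rv : repaint v s v = top b by rewrite /repaint eqxx.
case: (eqVneq x v) => [xv|xv]; first by rewrite xv in xy *; rewrite rv; exact: ends.
case: (eqVneq y v) => [yv|yv].
  rewrite yv in xy *; rewrite rv (link_sym ax) => l; apply/esym.
  by apply: ends l; exact: edge_sym.
move=> l; have l' := l; rewrite link_repaint // in l'.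
have l2 : link (s y) (s x) by rewrite (link_sym ax).
rewrite /repaint (negbTE xv) (negbTE yv).
case: asboolP => tx; case: asboolP => ty.
- rewrite !(sg_setb ax); have := link_sg ax l'; have := link_sg ax l2.
  by case: (sg (s x)); case: (sg (s y)).
- by case: ty; exact: linked_step tx xy l'.
- by case: tx; exact: linked_step ty (edge_sym xy) l2.
- exact: adm.
Qed.

Variable Lam : {fset V}.

Definition off_top (s : V -> S) := forall x, x \notin Lam -> s x = top b.

Lemma repaint_off_top v s : off_top s -> off_top (repaint v s).
Proof.
move=> h x xL; rewrite /repaint; case: eqP => // _; case: asboolP => _.
  by rewrite h // (setb_top ax).
exact: h.
Qed.

Lemma sg_touched s x y : admissible Lam s -> off_top s ->
  reach (linked s) [set: V] x y -> sg (s x) = sg (s y).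
Proof.
move=> adm off; elim=> // u u' _ -> /andP[uu' l] _.
case: (boolP (u \in Lam)) => uL; first by apply: adm => //; left.
case: (boolP (u' \in Lam)) => uL'; first by apply: adm => //; right.
by rewrite !off.
Qed.

(** Off v, repainting preserves links, hence clusters. The sign of a repainted
    cluster is recovered from any of its sites in the closed neighbourhood of v. *)
Lemma repaint_inj v s s' : admissible Lam s -> admissible Lam s' ->
  off_top s -> off_top s' -> repaint v s = repaint v s' ->
  (forall y, y = v \/ e v y -> s y = s' y) -> s = s'.
Proof.
move=> adm adm' off off' eqr eqN.
have eql : linked s = linked s'.
  apply/funext => x; apply/funext => y; rewrite /linked.
  case: (boolP (e x y)) => //= xy.
  case: (eqVneq x v) => [xv|xv].
    by rewrite xv in xy *; rewrite (eqN v (or_introl erefl)) (eqN y (or_intror xy)).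
  case: (eqVneq y v) => [yv|yv].
    rewrite yv in xy *; rewrite (eqN v (or_introl erefl)).
    by rewrite (eqN x (or_intror (edge_sym xy))).
  by rewrite -(link_repaint s xv yv) eqr link_repaint.
apply/funext => u; case: (eqVneq u v) => [->|uv]; first by apply: eqN; left.
have := congr1 (@^~ u) eqr; rewrite /repaint (negbTE uv) /touched eql.
case: asboolP => // -[y yv yu] /(setb_inj ax); apply.
rewrite -(sg_touched adm' off' yu) -(sg_touched adm off (y := u) (x := y)) ?eql //.
by rewrite eqN.
Qed.

Let conf (t : {ffun Lam -> S}) : V -> S := splice t eta.

Let conf_off t : off_top (conf t).
Proof. by move=> x xL; rewrite /conf splice_out. Qed.

Let W t := site_weight Lam (conf t).

Let W0 t : 0 <= W t. Proof. exact: spec_ge0 site_spec _ _. Qed.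

Let W_adm t : W t != 0 -> admissible Lam (conf t).
Proof. by rewrite /W /site_weight; case: asboolP => //; rewrite eqxx. Qed.

Variable D : nat.
Hypothesis degD : forall x, (setcard [set y | e x y] <= D)%N.

(** Repainting multiplies the weight by lam, and by [repaint_inj] its fibres have
    at most |S| ^ (D + 1) elements. *)
Lemma weak_step (v : V) (Z : seq V) : v \notin Z ->
  \sum_(t | all (fun x => ~~ strong (conf t x)) (v :: Z)) W t <=
  lam^-1 * (#|S| ^ D.+1)%N%:R * \sum_(t | all (fun x => ~~ strong (conf t x)) Z) W t.
Proof.
move=> vZ; have rhs0 : 0 <= \sum_(t | all (fun x => ~~ strong (conf t x)) Z) W t.
  by apply: sumr_ge0.
have S0 : (0 < #|S|)%N by apply/card_gt0P; exists point.
have li0 : 0 <= lam^-1 by rewrite invr_ge0 ltW.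
case: (boolP (v \in Lam)) => vL; last first.
  rewrite big1 ?mulr_ge0 // => t /= /andP[]; rewrite /conf splice_out //.
  by rewrite (strong_top ax).
have fN : finite_set [set y | e v y] by exact: graph_locally_finite.
pose N := (v |` fset_set [set y | e v y])%fset.
have NP y : y = v \/ e v y -> y \in N.
  by move=> [->|vy]; rewrite in_fsetU; [rewrite fset11|rewrite (in_fset_set fN) (@mem_set _ [set z | e v z] y vy) orbT].
have cN : (#|` N| <= D.+1)%N.
  apply: (@leq_trans (1 + #|` fset_set [set y | e v y]|)).
    by rewrite /N cardfsU1 leq_add2r leq_b1.
  by rewrite add1n ltnS; exact: degD.
pose f (t : {ffun Lam -> S}) : {ffun Lam -> S} :=
  [ffun u : Lam => repaint v (conf t) (val u)].
have confF t : conf (f t) = repaint v (conf t).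
  apply/funext => x; rewrite /conf; case: (boolP (x \in Lam)) => xL.
    by rewrite splice_self.
  by rewrite splice_out // (repaint_off_top v (@conf_off t)).
pose k (t : {ffun Lam -> S}) : {ffun N -> S} := [ffun u : N => conf t (val u)].
apply: (@le_trans _ _ (lam^-1 * #|{ffun N -> S}|%:R *
    \sum_(t | all (fun x => ~~ strong (conf t x)) Z) W t)); last first.
  apply: ler_wpM2r => //; apply: ler_wpM2l => //.
  by rewrite ler_nat card_ffun -cardfE leq_pexp2l.
apply: (injection_bound (f := f) (k := k)) => // [t /andP[nsv nsZ] Wt|t t' _ _ Wt Wt' ff kk].
  split; last first.
    apply/allP => x xZ; rewrite confF strong_repaint; first exact: (allP nsZ).
    by apply: contraNneq vZ => <-.
  rewrite /W confF /site_weight.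
  case: asboolP => [_|[]]; last exact: W_adm.
  case: asboolP => [_|[]]; last by apply: repaint_admissible; exact: W_adm.
  have -> : [fset x in Lam | strong (repaint v (conf t) x)]%fset =
      (v |` [fset x in Lam | strong (conf t x)])%fset.
    apply/fsetP => x; rewrite !inE; case: (eqVneq x v) => [->|xv] /=.
      by rewrite vL /repaint eqxx (strong_top ax).
    by rewrite strong_repaint.
  rewrite cardfsU1 !inE /= (negbTE nsv) andbF /= add1n exprS mulrA mulVf ?mul1r //.
  by rewrite gt_eqF.
have := congr1 conf ff; rewrite !confF => eqr.
have ctt : conf t = conf t'.
  apply: (repaint_inj (W_adm Wt) (W_adm Wt') (@conf_off t) (@conf_off t') eqr).
  move=> y /NP yN; have := congr1 (fun g : {ffun N -> S} => g [` yN]%fset) kk.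
  by rewrite !ffunE.
by apply/ffunP => u; rewrite -[t u](splice_in t eta) -[t' u](splice_in t' eta) -/(conf t) ctt.
Qed.

Lemma weak_bound (Z : seq V) : uniq Z ->
  \sum_(t | all (fun x => ~~ strong (conf t x)) Z) W t <=
  (lam^-1 * (#|S| ^ D.+1)%N%:R) ^+ size Z * \sum_t W t.
Proof.
elim: Z => [_|v Z IH /= /andP[vZ uZ]]; first by rewrite /= mul1r.
apply: le_trans (weak_step vZ) _; rewrite exprS -[leRHS]mulrA.
by apply: ler_wpM2l; [rewrite mulr_ge0 // invr_ge0 ltW | exact: IH].
Qed.

Variable eps : R.
Hypotheses (peps : peierls_bound e eps) (eps8 : eps <= 8^-1).
Hypothesis lam_eps : lam^-1 * (#|S| ^ D.+1)%N%:R <= eps.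

(** Either the spin at o is weak, or it has the wrong sign. In the second case the
    component of o in the wrong sign does not leave Lam, and it is sealed by weak
    sites, as adjacent strong spins agree in sign. *)
Lemma site_minority (o : V) :
  boundary_sum site_weight Lam eta [set s | sg (s o) <> Some b] <=
  3 / 8 * boundary_sum site_weight Lam eta setT.
Proof.
pose Cl (t : {ffun Lam -> S}) : pred V := fun x => ~~ strong (conf t x).
have l0 : 0 <= lam^-1 * (#|S| ^ D.+1)%N%:R by rewrite mulr_ge0 // invr_ge0 ltW.
have hZ (Z : seq V) : uniq Z ->
    \sum_(t | all (Cl t) Z) W t <= eps ^+ size Z * \sum_t W t.
  move=> /weak_bound h; apply: le_trans h _; apply: ler_wpM2r; first exact: sumr_ge0.
  by apply: lerXn2r; rewrite ?nnegrE // (le_trans l0).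
have -> : boundary_sum site_weight Lam eta setT = \sum_t W t.
  by apply: eq_bigl => t; apply/asboolP.
have h1 := peps o W0 hZ; have := hZ [:: o] isT; rewrite expr1 => h2.
set SW := \sum_t W t in h1 h2 *; have SW0 : 0 <= SW by apply: sumr_ge0.
rewrite /boundary_sum (bigID (fun t => Cl t o)) /=.
have -> : 3 / 8 * SW = 8^-1 * SW + 4^-1 * SW by field.
apply: lerD.
  apply: (@le_trans _ _ (eps * SW)); last exact: ler_wpM2r.
  apply: le_trans h2; apply: (@ler_sum_sub _ _ _ _ W) => // t /andP[_ ct] _.
  by rewrite /= ct.
apply: le_trans h1; apply: (@ler_sum_sub _ _ _ _ W) => // t.
rewrite /Cl negbK => /andP[/asboolP /= so sto] Wt.
have adm := W_adm Wt; have off := @conf_off t.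
have so' : sg (conf t o) = Some (~~ b).
  have := link_sg ax (strong_link ax sto sto); move: so; rewrite -/(conf t).
  by case: (sg (conf t o)) => // -[]; case: (b).
apply/asboolP; exists (reach e [set x | sg (conf t x) = Some (~~ b)] o); split.
- apply: (@sub_finite_set _ _ [set` Lam]); last exact: finite_fset.
  move=> x /reach_in /= sx; apply: contrapT => /negP xL.
  by move: sx; rewrite off // (sg_top ax); case: (b).
- exact: comp_connected.
- exact: reach0.
- move=> x y xy ox _ noy; have /= sx := reach_in ox.
  have sy : sg (conf t y) <> Some (~~ b).
    by move=> sy; apply: noy; exact: (reachS ox xy).
  case: (boolP (Cl t x)) => [|nx]; first by left.
  case: (boolP (Cl t y)) => [|ny]; first by right.
  rewrite /Cl !negbK in nx ny; case: sy; rewrite -sx.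
  have l := strong_link ax nx ny.
  apply/esym/(sg_touched adm off); apply: (reachS (reach0 _)) => //.
  by rewrite /linked xy.
Qed.

End SiteModel.

(** * The Widom-Rowlinson and beach models *)

Section SitePhases.
Context {R : realType} {V : choiceType} {e : rel V} {G : infinite_graph e}.
Hypothesis eirr : irreflexive e.
Variables (S : finPointedType) (sg : S -> option bool) (strong : pred S)
  (link : rel S) (setb : bool -> S -> S) (top : bool -> S).
Hypothesis ax : spin_axioms sg strong link setb top.
Variables (eps : R) (D : nat).
Hypotheses (eps0 : 0 < eps) (eps8 : eps <= 8^-1) (peps : peierls_bound e eps).
Hypothesis degD : forall x, (setcard [set y | e x y] <= D)%N.

(** A large activity makes weak spins rare. *)
Lemma site_phases (o : V) : exists2 lam : R, 0 < lam &
  multiple_gibbs (site_weight (e := e) sg strong link lam).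
Proof.
have S0 : 0 < (#|S| ^ D.+1)%N%:R :> R.
  by rewrite ltr0n expn_gt0; apply/orP; left; apply/card_gt0P; exists point.
pose lam : R := (#|S| ^ D.+1)%N%:R / eps; have lam0 : 0 < lam by exact: divr_gt0.
have le : lam^-1 * (#|S| ^ D.+1)%N%:R <= eps.
  by rewrite /lam invf_div mulfVK // gt_eqF.
have minority c L := site_minority (G := G) eirr ax lam0 c L degD peps eps8 le o.
exists lam => //.
apply: (@two_phases _ _ e G _ _ (site_spec sg strong link lam0) o (fun=> top true)
  (fun=> top false) [set s | sg (s o) = Some true]).
- by move=> s s' /= ->.
- exact: (site_top_gt0 ax).
- exact: (site_top_gt0 ax).
- by move=> L; exact: minority.
- move=> L; apply: le_trans (minority false L).
  apply: (ler_sum_sub (F := fun t : {ffun L -> S} =>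
    site_weight (e := e) sg strong link lam L (splice t (fun=> top false)))).
    by move=> t; exact: spec_ge0 (site_spec sg strong link lam0) _ _.
  by move=> t /asboolP /= h _; apply/asboolP => /=; rewrite h.
Qed.

End SitePhases.

Section WidomRowlinson.

Definition wr_plus : wr_spin := @SeqSub int [:: -1; 0; 1] 1 isT.
Definition wr_zero : wr_spin := @SeqSub int [:: -1; 0; 1] 0 isT.
Definition wr_minus : wr_spin := @SeqSub int [:: -1; 0; 1] (-1) isT.

Lemma wr_cases (s : wr_spin) : [\/ s = wr_plus, s = wr_zero | s = wr_minus].
Proof.
case: s => x xS; have := xS; rewrite !inE => /or3P[] /eqP xE.
- by constructor 3; exact: val_inj.
- by constructor 2; exact: val_inj.
- by constructor 1; exact: val_inj.
Qed.

Definition wr_top (b : bool) : wr_spin := if b then wr_plus else wr_minus.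
(** A Widom-Rowlinson spin carries no information beyond its sign. *)
Definition wr_of (o : option bool) : wr_spin := oapp wr_top wr_zero o.
Definition wr_sg (s : wr_spin) : option bool :=
  if ssval s == 0 then None else Some (ssval s == 1).
Definition wr_occupied (s : wr_spin) : bool := ssval s != 0.
Definition wr_link (s t : wr_spin) : bool := wr_occupied s && wr_occupied t.
Definition wr_setb (b : bool) (s : wr_spin) : wr_spin :=
  wr_of (omap (fun=> b) (wr_sg s)).

Lemma wr_ofK : cancel wr_of wr_sg.
Proof. by case=> [[]|]. Qed.

Lemma wr_sgK : cancel wr_sg wr_of.
Proof. by move=> s; case: (wr_cases s) => ->; apply: val_inj. Qed.

Lemma wr_occupiedE s : wr_occupied s = isSome (wr_sg s).
Proof. by rewrite /wr_occupied /wr_sg; case: eqP. Qed.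

Lemma wr_axioms : spin_axioms wr_sg wr_occupied wr_link wr_setb wr_top.
Proof.
have topE b : wr_top b = wr_of (Some b) by [].
split.
- by move=> s t; rewrite /wr_link andbC.
- by move=> s t; rewrite /wr_link !wr_occupiedE; case: (wr_sg s).
- by move=> s t; rewrite /wr_link => -> ->.
- by move=> b s t; rewrite /wr_link !wr_occupiedE /wr_setb wr_ofK; case: (wr_sg s).
- by move=> b s; rewrite /wr_setb wr_ofK.
- by move=> b s; rewrite !wr_occupiedE /wr_setb wr_ofK; case: (wr_sg s).
- by move=> b s t _ st; rewrite -(wr_sgK s) st wr_sgK.
- by move=> b; rewrite wr_occupiedE topE wr_ofK.
- by move=> b; rewrite topE wr_ofK.
- by move=> b; rewrite /wr_setb topE wr_ofK.
Qed.

Lemma wr_minusE s : ssval s = -1 <-> wr_sg s = Some false.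
Proof. by rewrite -(wr_sgK s) wr_ofK; case: (wr_sg s) => [[]|]. Qed.

Lemma wr_plusE s : ssval s = 1 <-> wr_sg s = Some true.
Proof. by rewrite -(wr_sgK s) wr_ofK; case: (wr_sg s) => [[]|]. Qed.

Lemma wr_weightE (R : realType) (V : choiceType) (e : rel V) (lam : R) :
  symmetric e ->
  wr_weight e lam = site_weight (e := e) wr_sg wr_occupied wr_link lam.
Proof.
move=> esym; apply/funext => L; apply/funext => s; rewrite /wr_weight /site_weight.
have cE (s' t' : wr_spin) : (wr_link s' t' -> wr_sg s' = wr_sg t') <->
    ~ (ssval s' = -1 /\ ssval t' = 1) /\ ~ (ssval t' = -1 /\ ssval s' = 1).
  rewrite !wr_minusE !wr_plusE /wr_link !wr_occupiedE.
  split=> [h|[]].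
    by split=> -[ss tt]; move: h; rewrite ss tt => /(_ isT).
  by case: (wr_sg s') => [[]|]; case: (wr_sg t') => [[]|] //= h1 h2 _; [case: h2|case: h1].
congr (if _ then _ else _); apply/asboolP/asboolP => h x y xy xyL.
  apply/cE; split; first exact: h.
  by apply: h; [rewrite esym | case: xyL; [right|left]].
by have /cE[] := h x y xy xyL.
Qed.

End WidomRowlinson.

Section Beach.

Definition beach_val (strong b : bool) : beach_spin :=
  if strong then if b then @SeqSub int [:: -2; -1; 1; 2] 2 isT
                 else @SeqSub int [:: -2; -1; 1; 2] (-2) isT
  else if b then @SeqSub int [:: -2; -1; 1; 2] 1 isT
       else @SeqSub int [:: -2; -1; 1; 2] (-1) isT.

Definition beach_strong (s : beach_spin) : bool := `|ssval s| == 2.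
Definition beach_pos (s : beach_spin) : bool := 0 < ssval s.
Definition beach_link (s t : beach_spin) : bool := beach_strong s || beach_strong t.
Definition beach_setb (b : bool) (s : beach_spin) : beach_spin :=
  beach_val (beach_strong s) b.

Lemma beach_cases (s : beach_spin) : s = beach_val (beach_strong s) (beach_pos s).
Proof.
case: s => x xS; have := xS; rewrite !inE => /or4P[] /eqP xE; subst x; exact: val_inj.
Qed.

Lemma beach_axioms : spin_axioms (fun s => Some (beach_pos s)) beach_strong
  beach_link beach_setb (beach_val true).
Proof.
have strongE a b : beach_strong (beach_val a b) = a by case: a b => [] [].
have posE a b : beach_pos (beach_val a b) = b by case: a b => [] [].
split; rewrite /beach_link /beach_setb => //.
- by move=> s t; rewrite orbC.
- by move=> s t ->.
- by move=> b s t; rewrite strongE.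
- by move=> b s; exact: (congr1 Some (posE _ _)).
- move=> b s t /(congr1 beach_strong); rewrite !strongE => st [pt].
  by rewrite (beach_cases s) (beach_cases t) st pt.
- by move=> b; rewrite strongE.
- by move=> b; exact: (congr1 Some (posE _ _)).
- by move=> b; rewrite strongE.
Qed.

Lemma beach_weightE (R : realType) (V : choiceType) (e : rel V) (lam : R) :
  beach_weight e (1 + lam) =
  site_weight (e := e) (fun s => Some (beach_pos s)) beach_strong beach_link lam.
Proof.
apply/funext => L; apply/funext => s; rewrite /beach_weight /site_weight.
rewrite [1 + lam]addrC addrK.
have cE (s' t' : beach_spin) : (-1 <= ssval s' * ssval t') <->
    (beach_link s' t' -> Some (beach_pos s') = Some (beach_pos t')).
  rewrite (beach_cases s') (beach_cases t').
  by case: (beach_strong s') (beach_pos s') (beach_strong t') (beach_pos t')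
    => [] [] [] []; split => // /(_ isT).
by congr (if _ then _ else _); apply/asboolP/asboolP => h x y xy xyL; apply/cE; exact: h.
Qed.

End Beach.

(** * The Ising model *)

Definition ising_top (b : bool) : ising_spin :=
  if b then @SeqSub int [:: -1; 1] 1 isT else @SeqSub int [:: -1; 1] (-1) isT.

Lemma ising_cases (s : ising_spin) : exists b, s = ising_top b.
Proof.
case: s => x xS; have := xS; rewrite !inE => /orP[] /eqP xE.
- by exists false; exact: val_inj.
- by exists true; exact: val_inj.
Qed.

Section IsingWeights.
Context {R : realType} {V : choiceType} {e : rel V} {G : infinite_graph e}.
Hypothesis eirr : irreflexive e.

Definition sv (s : ising_spin) : R := (ssval s)%:~R.

Lemma sv_top b : sv (ising_top b) = (-1) ^+ (~~ b).
Proof. by case: b; rewrite /sv /= ?expr0 ?expr1 // mulrN1z. Qed.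

Lemma sv_sq s : sv s * sv s = 1.
Proof. by have [b ->] := ising_cases s; rewrite sv_top -expr2 sqrr_sign. Qed.

Lemma sv_neq s t : s != t -> sv s * sv t = -1.
Proof.
have [b ->] := ising_cases s; have [c ->] := ising_cases t; rewrite !sv_top.
by case: b; case: c => //= _; rewrite expr0 expr1 ?mulr1 ?mul1r.
Qed.

(** For an edge, the product of its two spins. *)
Definition chi (s : V -> ising_spin) (b : {fset V}) : R :=
  \prod_(x <- enum_fset b) sv (s x).

Lemma chi2 s x y : x != y -> chi s [fset x; y]%fset = sv (s x) * sv (s y).
Proof.
move=> xy; rewrite /chi -[LHS]/(\prod_(z <- [fset x; y]%fset) _).
by rewrite big_fsetU1 ?inE //= big_seq_fset1.
Qed.

Definition edges (L : {fset V}) : {fset {fset V}} := fset_set (edges_meeting e L).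

Lemma edges_finite (L : {fset V}) : finite_set (edges_meeting e L).
Proof.
apply: (@sub_finite_set _ _ (\bigcup_(x in [set` L])
    ((fun y => [fset x; y]%fset) @` [set y | e x y]))).
  by move=> b [x [y [xy xL ->]]]; exists x => //; exists y.
by apply: bigcup_finite => // x _; apply: finite_image; exact: graph_locally_finite.
Qed.

Lemma edgesP (L : {fset V}) b : b \in edges L <->
  exists x y, [/\ e x y, x \in L & b = [fset x; y]%fset].
Proof. by rewrite /edges in_fset_set ?inE //; exact: edges_finite. Qed.

Lemma ising_weightE J L s :
  ising_weight e J L s = expR (\sum_(b <- edges L) J * chi s b).
Proof. by rewrite /ising_weight fsbig_finite ?mulr_sumr //; exact: edges_finite. Qed.

Lemma ising_spec J : specification (ising_weight (R := R) e J).
Proof.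
split.
- by move=> L s; exact: expR_ge0.
- move=> L; exists (closed_nbhd (e := e) L) => s s' ss'; rewrite !ising_weightE.
  congr expR; rewrite !big_seq; apply: eq_bigr => _ /edgesP[x [y [xy xL ->]]].
  congr (_ * _); rewrite !chi2; last 2 first.
    by apply: contraTneq xy => ->; rewrite eirr.
    by apply: contraTneq xy => ->; rewrite eirr.
  rewrite !ss' //; first by apply: (closed_nbhdP xL); exact: gdist_edge.
  exact: sub_closed_nbhd.
- move=> L M LM; exists (fun s => expR (\sum_(b <- edges M | b \notin edges L) J * chi s b)).
  have sub : {subset edges L <= edges M}.
    by move=> b /edgesP[x [y [xy xL ->]]]; apply/edgesP; exists x, y; split => //; exact: LM.
  split.
    move=> s; rewrite !ising_weightE -expRD; congr expR.
    rewrite (bigID (mem (edges L))) /=; congr (_ + _).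
    rewrite -big_filter; apply: perm_big; apply: uniq_perm.
    + by rewrite filter_uniq // fset_uniq.
    + exact: fset_uniq.
    + move=> b; rewrite mem_filter /=; case: (boolP (b \in edges L)) => //= bL.
      exact: sub.
  move=> s s' ss'; congr expR; rewrite big_seq_cond [RHS]big_seq_cond.
  apply: eq_bigr => _ /andP[/edgesP[x [y [xy xM ->]]] nL].
  have xL : x \notin L.
    by apply: contra nL => xL; apply/edgesP; exists x, y.
  have yL : y \notin L.
    apply: contra nL => yL; apply/edgesP; exists y, x; split => //; last exact: fsetUC.
    exact: edge_sym.
  have xy' : x != y by apply: contraTneq xy => ->; rewrite eirr.
  by rewrite !chi2 // !ss'.
Qed.

Variables (Lam : {fset V}) (b : bool).
Let eta : V -> ising_spin := fun=> ising_top b.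
Let conf (t : {ffun Lam -> ising_spin}) : V -> ising_spin := splice t eta.

(* Edge products do not change when both spins are multiplied by the boundary
   spin, and this turns the boundary condition into + in both cases. *)
Let rel_spin (s : ising_spin) : R := sv (ising_top b) * sv s.

Lemma rel_spin_moment k : 0 <= \sum_(s : ising_spin) rel_spin s ^+ k.
Proof.
rewrite (bigD1 (ising_top b)) //= (bigD1 (ising_top (~~ b))) /=; last by case: (b).
rewrite big1 ?addr0.
  rewrite /rel_spin sv_sq expr1n sv_neq; last by case: (b).
  by rewrite -signr_odd; case: (odd k); rewrite ?expr0 ?expr1 ?subrr // addr_ge0.
by move=> s; have [c ->] := ising_cases s; case: (b); case: c.
Qed.

(** Off Lam the relative spins are 1, so that only the multiplicities of the sites
    of Lam matter. *)
Lemma monomial_prod (l : seq V) t : \prod_(x <- l) rel_spin (conf t x) =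
  \prod_(u : Lam) rel_spin (t u) ^+ count_mem (val u) l.
Proof.
elim: l => [|x l IH]; first by rewrite big_nil big1.
rewrite big_cons IH /=.
under [RHS]eq_bigr do rewrite exprD.
rewrite big_split /=; congr (_ * _).
case: (boolP (x \in Lam)) => xL.
  rewrite (bigD1 [` xL]%fset) //= eqxx expr1 big1 ?mulr1.
    by rewrite -[x in conf t x]/(val [` xL]%fset) /conf splice_in.
  by move=> u ux; rewrite (_ : x == val u = false) // eq_sym; apply: contraNF ux => /eqP ux; exact/eqP/val_inj.
rewrite /conf splice_out // /rel_spin sv_sq big1 // => u _.
rewrite (_ : x == val u = false) //; apply: contraNF xL => /eqP ->; exact: fsvalP.
Qed.

Lemma griffiths_monomial (l : seq V) :
  0 <= \sum_(t : {ffun Lam -> ising_spin}) \prod_(x <- l) rel_spin (conf t x).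
Proof.
under eq_bigr do rewrite monomial_prod.
rewrite -(bigA_distr_bigA (fun (u : Lam) s => rel_spin s ^+ count_mem (val u) l)).
by apply: prodr_ge0 => u _; exact: rel_spin_moment.
Qed.

Definition is_edge (a : {fset V}) := exists x y, x != y /\ a = [fset x; y]%fset.

Lemma chi_rel s a : is_edge a -> chi s a = \prod_(x <- enum_fset a) rel_spin (s x).
Proof.
move=> [x [y [xy ->]]]; rewrite chi2 //.
rewrite -[RHS]/(\prod_(z <- [fset x; y]%fset) _) big_fsetU1 ?inE //= big_seq_fset1.
by rewrite /rel_spin mulrACA sv_sq mul1r.
Qed.

Lemma expR_chi s a c : is_edge a -> expR (c * chi s a) =
  (expR c + expR (- c)) / 2 + (expR c - expR (- c)) / 2 * chi s a.
Proof.
move=> [x [y [xy ->]]]; rewrite chi2 //.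
case: (eqVneq (s x) (s y)) => [->|/sv_neq ->]; first by rewrite sv_sq !mulr1; field.
by rewrite !mulrN1; field.
Qed.

(** Griffiths' inequality. Each factor exp (c chi) is a combination of 1 and chi
    with nonnegative coefficients, and sums of monomials factor over the sites. *)
Lemma griffiths (E : seq {fset V}) (c : {fset V} -> R) (l : seq V) :
  (forall a, a \in E -> is_edge a) -> (forall a, 0 <= c a) ->
  0 <= \sum_(t : {ffun Lam -> ising_spin})
    (\prod_(a <- E) expR (c a * chi (conf t) a)) * \prod_(x <- l) rel_spin (conf t x).
Proof.
move=> edg c0; elim: E edg l => [|a E IH] edg l.
  by under eq_bigr do rewrite big_nil mul1r; exact: griffiths_monomial.
have ea : is_edge a by apply: edg; rewrite mem_head.
have IH' := IH (fun a' h => edg a' (mem_behead (s := a :: E) h)).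
pose p := (expR (c a) + expR (- c a)) / 2; pose q := (expR (c a) - expR (- c a)) / 2.
have p0 : 0 <= p by rewrite divr_ge0 // addr_ge0 ?expR_ge0.
have q0 : 0 <= q by rewrite divr_ge0 // subr_ge0 ler_expR; have := c0 a; lra.
rewrite (_ : \sum_(t : {ffun Lam -> ising_spin}) _ =
  p * (\sum_(t : {ffun Lam -> ising_spin}) (\prod_(a <- E) expR (c a * chi (conf t) a))
     * \prod_(x <- l) rel_spin (conf t x)) +
  q * (\sum_(t : {ffun Lam -> ising_spin}) (\prod_(a <- E) expR (c a * chi (conf t) a))
     * \prod_(x <- enum_fset a ++ l) rel_spin (conf t x))).
  by rewrite addr_ge0 // mulr_ge0.
rewrite !mulr_sumr -big_split /=; apply: eq_bigr => t _.
rewrite big_cons expR_chi // -/p -/q big_cat /= -chi_rel //; ring.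
Qed.

Variable E : seq {fset V}.
Hypotheses (E_edge : forall a, a \in E -> is_edge a) (uE : uniq E).

Let weight (c : {fset V} -> R) t := expR (\sum_(a <- E) c a * chi (conf t) a).

(** As exp (del chi) >= 1 + del chi, the gain is at least del times a sum that is
    nonnegative by Griffiths' inequality. *)
Lemma partition_mono (c : {fset V} -> R) a0 del : a0 \in E -> 0 <= del ->
  (forall a, a != a0 -> 0 <= c a) -> del <= c a0 ->
  let c' a := c a - (if a == a0 then del else 0) in
  \sum_t weight c' t <= \sum_t weight c t /\
  forall t, weight c' t = expR (- (del * chi (conf t) a0)) * weight c t.
Proof.
move=> a0E del0 c0 dc c'.
have wE t : weight c' t = expR (- (del * chi (conf t) a0)) * weight c t.
  have S : \sum_(a <- E) (if a == a0 then del else 0) * chi (conf t) a =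
      del * chi (conf t) a0.
    rewrite (bigD1_seq a0) //= eqxx big1 ?addr0 // => a /negbTE ->.
    by rewrite mul0r.
  rewrite /weight -expRD; congr expR; rewrite -S addrC -sumrB.
  by apply: eq_bigr => a _; rewrite /c' mulrBl.
split => //; rewrite -subr_ge0 -sumrB.
have wE' t : weight c t = expR (del * chi (conf t) a0) * weight c' t.
  by rewrite wE mulrA -expRD subrr expR0 mul1r.
have c'0 a : 0 <= c' a.
  by rewrite /c'; case: eqVneq => [->|/c0]; [rewrite subr_ge0|rewrite subr0].
have := griffiths (enum_fset a0) E_edge c'0.
set GS := \sum_t _ => G0.
apply: (@le_trans _ _ (del * GS)); first exact: mulr_ge0.
rewrite mulr_sumr; apply: ler_sum => t _.
rewrite wE' -chi_rel; last exact: E_edge.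
have -> : \prod_(a <- E) expR (c' a * chi (conf t) a) = weight c' t by rewrite /weight expR_sum.
have := expR_ge1Dx (del * chi (conf t) a0).
have := expR_ge0 (\sum_(a <- E) c' a * chi (conf t) a); rewrite -/(weight c' t).
by nra.
Qed.


Definition nbrs (z : V) : {fset V} := fset_set [set y | e z y].

Lemma nbrsP z y : y \in nbrs z = e z y.
Proof.
have fN : finite_set [set y | e z y] by exact: graph_locally_finite.
by rewrite /nbrs (in_fset_set fN); apply/idP/idP => [/set_mem|zy]; last exact: mem_set.
Qed.

Definition frustrated (s : V -> ising_spin) (z : V) : bool :=
  has (fun y => s z != s y) (nbrs z).

Variables (D : nat) (J : R).
Hypothesis degD : forall x, (setcard [set y | e x y] <= D)%N.
Hypothesis J0 : 0 <= J.
Hypothesis E_frustrated : forall t z y, e z y -> conf t z != conf t y ->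
  [fset z; y]%fset \in E.

(** If z disagrees with its neighbour y, then chi = -1 on the edge zy, where
    exp (- (J / 2) (1 + chi)) is 1. This factor lowers the coupling of the edge
    by J / 2 and costs exp (- (J / 2)). An edge serves at most once for each of
    its two ends, which the hypothesis on c accounts for. *)
Lemma frustrated_bound (Z : seq V) (c : {fset V} -> R) : uniq Z ->
  (forall a, 0 <= c a) ->
  (forall a, a \in E -> J / 2 * (count (mem a) Z)%:R <= c a) ->
  \sum_(t | all (frustrated (conf t)) Z) weight c t <=
  (D%:R * expR (- (J / 2))) ^+ size Z * \sum_t weight c t.
Proof.
elim: Z c => [|z Z IH] c; first by rewrite /= mul1r.
move=> /= /andP[zZ uZ] c0 cZ; have w0 c' t : 0 <= weight c' t by exact: expR_ge0.
set q := expR (- (J / 2)); set B := D%:R * q.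
have B0 : 0 <= B by rewrite mulr_ge0 // expR_ge0.
have J2 : 0 <= J / 2 by rewrite divr_ge0.
pose ey y := [fset z; y]%fset.
pose c' y a := c a - (if a == ey y then J / 2 else 0).
have zy_neq y : ey y \in E -> y \in nbrs z -> z != y.
  by move=> _; rewrite nbrsP; apply: contraTneq => ->; rewrite eirr.
have le1 y : ey y \in E -> J / 2 <= c (ey y).
  move=> yE; apply: le_trans (cZ _ yE); rewrite -[leLHS]mulr1; apply: ler_wpM2l => //.
  by rewrite ler1n /= !inE eqxx.
have mono y : ey y \in E -> \sum_t weight (c' y) t <= \sum_t weight c t /\
    forall t, weight (c' y) t = expR (- (J / 2 * chi (conf t) (ey y))) * weight c t.
  by move=> yE; apply: partition_mono => // ; exact: le1.
apply: (@le_trans _ _ (\sum_(t | all (frustrated (conf t)) Z)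
    \sum_(y <- nbrs z | ey y \in E) q * weight (c' y) t)).
  rewrite big_mkcond [leRHS]big_mkcond; apply: ler_sum => t _.
  case: (boolP (all _ Z)) => aZ; last by rewrite andbF.
  rewrite andbT; case: ifPn => [/hasP[y yz dis]|_]; last first.
    by apply: sumr_ge0 => y _; rewrite mulr_ge0 // expR_ge0.
  have zy : e z y by rewrite -nbrsP.
  have yE : ey y \in E by exact: E_frustrated dis.
  rewrite [leRHS]big_mkcond (bigD1_seq y) ?fset_uniq //= yE.
  have -> : weight c t = q * weight (c' y) t.
    have [_ ->] := mono y yE; rewrite chi2; last exact: zy_neq.
    by rewrite sv_neq // mulrA -expRD mulrN1 opprK addNr expR0 mul1r.
  by rewrite lerDl; apply: sumr_ge0 => y' _; case: ifP => // _; rewrite mulr_ge0 // expR_ge0.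
rewrite exchange_big /=.
apply: (@le_trans _ _ (\sum_(y <- nbrs z | ey y \in E)
    q * (B ^+ size Z * \sum_t weight c t))).
  apply: ler_sum => y yE; rewrite -mulr_sumr; apply: ler_wpM2l; first exact: expR_ge0.
  apply: (@le_trans _ _ (B ^+ size Z * \sum_t weight (c' y) t)).
    apply: IH => // [a|a aE]; rewrite /c'; case: (eqVneq a (ey y)) => [aey|_].
    - by rewrite aey subr_ge0 le1.
    - by rewrite subr0.
    - rewrite lerBrDr; apply: le_trans (cZ _ aE).
      by rewrite /= aey !inE eqxx /= natrD mulrDr mulr1 addrC.
    - rewrite subr0; apply: le_trans (cZ _ aE); apply: ler_wpM2l => //.
      by rewrite ler_nat /= leq_addl.
  by apply: ler_wpM2l; [exact: exprn_ge0 | have [] := mono y yE].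
set X := q * _; have X0 : 0 <= X.
  by rewrite mulr_ge0 ?expR_ge0 // mulr_ge0 ?exprn_ge0 //; apply: sumr_ge0.
rewrite exprS -mulrA /B -[in leRHS]mulrA -/B -/X.
apply: (@le_trans _ _ (\sum_(y <- nbrs z) X)).
  by rewrite big_mkcond; apply: ler_sum => y _; case: ifP.
rewrite big_const_seq count_predT iter_addr_0 -[leLHS]mulr_natl. apply: ler_wpM2r => //.
by rewrite ler_nat; exact: degD.
Qed.

End IsingWeights.

Section IsingPhases.
Context {R : realType} {V : choiceType} {e : rel V} {G : infinite_graph e}.
Hypothesis eirr : irreflexive e.
Variables (eps : R) (D : nat).
Hypotheses (eps0 : 0 < eps) (peps : peierls_bound e eps).
Hypothesis degD : forall x, (setcard [set y | e x y] <= D)%N.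

(** The component of o in the wrong spin does not leave Lam, and the inner ends of
    its boundary edges are frustrated. *)
Lemma ising_minority (Lam : {fset V}) b J o : 0 <= J ->
  D%:R * expR (- (J / 2)) <= eps ->
  boundary_sum (ising_weight e J) Lam (fun=> ising_top b)
    [set s | s o <> ising_top b] <=
  3 / 8 * boundary_sum (ising_weight e J) Lam (fun=> ising_top b) setT.
Proof.
move=> J0 hJ; pose conf (t : {ffun Lam -> ising_spin}) := splice t (fun=> ising_top b : ising_spin).
pose W t := ising_weight e J Lam (conf t).
have W0 t : 0 <= W t by exact: expR_ge0.
have edgeE a : a \in edges (e := e) Lam -> is_edge a.
  move=> /edgesP[x [y [xy _ ->]]]; exists x, y; split => //.
  by apply: contraTneq xy => ->; rewrite eirr.
have frE t z y : e z y -> conf t z != conf t y -> [fset z; y]%fset \in edges (e := e) Lam.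
  move=> zy; case: (boolP (z \in Lam)) => zL; first by move=> _; apply/edgesP; exists z, y.
  case: (boolP (y \in Lam)) => yL.
    by move=> _; apply/edgesP; exists y, z; split => //; [exact: edge_sym|exact: fsetUC].
  by rewrite /conf !splice_out // eqxx.
pose Cl t : pred V := frustrated (e := e) (conf t).
have hZ (Z : seq V) : uniq Z ->
    \sum_(t | all (Cl t) Z) W t <= eps ^+ size Z * \sum_t W t.
  move=> uZ.
  have WE : W = fun t => expR (\sum_(a <- edges (e := e) Lam) J * chi (conf t) a).
    by apply/funext => t; exact: ising_weightE.
  have hc a : a \in edges (e := e) Lam -> J / 2 * (count (mem a) Z)%:R <= J.
    move=> /edgesP[x [y [_ _ ->]]]; rewrite -[leRHS](divfK (_ : 2 != 0 :> R)) //.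
    apply: ler_wpM2l; first exact: divr_ge0.
    rewrite ler_nat -size_filter -[X in (_ <= X)%N]/(size [:: x; y]).
    apply: uniq_leq_size; first exact: filter_uniq.
    by move=> z; rewrite mem_filter /= !inE => /andP[].
  apply: (@le_trans _ _ ((D%:R * expR (- (J / 2))) ^+ size Z * \sum_t W t)).
    rewrite WE.
    exact: (frustrated_bound eirr edgeE (fset_uniq _) degD J0 frE uZ (fun=> J0) hc).
  apply: ler_wpM2r; first exact: sumr_ge0.
  by apply: lerXn2r; rewrite ?nnegrE ?(ltW eps0) // mulr_ge0 // expR_ge0.
have -> : boundary_sum (ising_weight e J) Lam (fun=> ising_top b) setT = \sum_t W t.
  by apply: eq_bigl => t; apply/asboolP.
have h1 := peps o W0 hZ.
have SW0 : 0 <= \sum_t W t by apply: sumr_ge0.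
apply: (@le_trans _ _ (4^-1 * \sum_t W t)); last by apply: ler_wpM2r => //; lra.
apply: le_trans h1; apply: (@ler_sum_sub _ _ _ _ W) => // t /asboolP /= so _.
apply/asboolP; exists (reach e [set x | conf t x <> ising_top b] o); split.
- apply: (@sub_finite_set _ _ [set` Lam]); last exact: finite_fset.
  move=> x /reach_in /= sx; apply: contrapT => /negP xL.
  by apply: sx; rewrite /conf splice_out.
- exact: comp_connected.
- exact: reach0.
- move=> x y xy ox _ noy; have /= sx := reach_in ox.
  left; apply/hasP; exists y; first by rewrite nbrsP.
  apply/eqP => sxy; apply: noy; apply: (reachS ox xy) => /=.
  by rewrite -sxy.
Qed.

Lemma ising_phases (o : V) : exists2 J : R, 0 <= J & multiple_gibbs (ising_weight e J).
Proof.
(* with exp (J / 2) >= J / 2, this gives D exp (- (J / 2)) <= eps *)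
pose J : R := 2 * D.+1%:R / eps.
have J0 : 0 <= J by rewrite divr_ge0 ?mulr_ge0 // ltW.
have hJ : D%:R * expR (- (J / 2)) <= eps.
  have J2 : J / 2 = D.+1%:R / eps by rewrite /J; field; rewrite gt_eqF.
  rewrite expRN ler_pdivrMr ?expR_gt0 //.
  apply: (@le_trans _ _ (eps * (J / 2))).
    by rewrite J2 mulrCA divff ?gt_eqF // mulr1 ler_nat.
  apply: ler_wpM2l; first exact: ltW.
  by apply: le_trans (expR_ge1Dx _); rewrite lerDr.
exists J => //; have minority c L := ising_minority L c o J0 hJ.
apply: (@two_phases _ _ e G _ _ (ising_spec eirr J) o (fun=> ising_top true)
  (fun=> ising_top false) [set s | s o = ising_top true]).
- by move=> s s' /= ->.
- by move=> L; exact: expR_gt0.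
- by move=> L; exact: expR_gt0.
- by move=> L; exact: minority.
- move=> L; apply: le_trans (minority false L).
  apply: (ler_sum_sub (F := fun t : {ffun L -> ising_spin} =>
    ising_weight e J L (splice t (fun=> ising_top false)))).
    by move=> t; exact: expR_ge0.
  by move=> t /asboolP /= h _; apply/asboolP => /=; rewrite h.
Qed.

End IsingPhases.

(** * The three models *)

Theorem corollary1p6 (R : realType) (d_i d_u c_i c_u : R)
    (hdi : 1 < d_i) (hdu : 1 < d_u) (hci : 0 < c_i) (hcu : 0 < c_u)
    (V : choiceType) (e : rel V)
    (esym : symmetric e) (eirr : irreflexive e)
    (Vinf : infinite_set [set: V])
    (econn : connected_graph e)
    (elf : locally_finite e)
    (hL : local_isoperimetric e d_i c_i)
    (hVu : volume_upper_bound e d_u c_u) :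
  (bounded_degree e ->
     [/\ ising_phase_transition R e,
         wr_phase_transition R e &
         beach_phase_transition R e]) /\
  ising_phase_transition R e.
Proof.
have G : infinite_graph e by [].
have [[eps [eps0 eps8 peps]] [D degD]] := peierls_exists G hdi hci hcu hL hVu.
have [v _] := infinite_setN0 Vinf.
have ising : ising_phase_transition R e by exact: (ising_phases eirr eps0 peps degD v).
split => // _; split => //.
- have [lam lam0 h] := site_phases eirr wr_axioms eps0 eps8 peps degD v.
  by exists lam; rewrite // wr_weightE.
- have [lam lam0 h] := site_phases eirr beach_axioms eps0 eps8 peps degD v.
  by exists (1 + lam); rewrite ?ltrDl // beach_weightE.
Qed.
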